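(* For the sorting problem under uncertainty for a single set, there is a polynomial-time algorithm with competitive ratio $\min\{1+k/\mathrm{opt}, 2\}$ (i.e., it makes at most $\min\{\mathrm{opt}+k, 2\cdot\mathrm{opt}\}$ queries on every instance), for any error measure $k \in \{k_{\#}, k_M, k_h\}$.
   Context: Sorting a single set under uncertainty: given intervals $I_1,\dots,I_n$, each open $(L_i,U_i)$ or trivial $\{w_i\}$, with predicted values $\bar w_i\in I_i$ and unknown true values $w_i\in I_i$ (revealed by queries), determine the order of the intervals by true value. A query set $Q$ is feasible if the order is the same for all value assignments in the intervals agreeing with the true values on $Q$; $\mathrm{opt}$ is the minimum size of a feasible query set; the algorithm queries adaptively until its queries are feasible. Error measures: $k_{\#}=|\{i:w_i\ne\bar w_i\}|$. $k_M=|\mathcal{I}_P\triangle\mathcal{I}_R|$, where $\mathcal{I}_R$ is the set of intervals in every feasible query set and $\mathcal{I}_P$ the set of intervals in every feasible query set when the true values are assumed to equal the predictions. $k_h$: for non-trivial $I_j=(L_j,U_j)$, the value of $I_i$ passes over $L_j$ if one of $w_i,\bar w_i$ is $\le L_j$ and the other $>L_j$, and passes over $U_j$ if one is $<U_j$ and the other $\ge U_j$; for trivial $I_j=\{w_j\}$ it jumps over $I_j$ if one of $w_i,\bar w_i$ is $<w_j$ and the other $>w_j$; $h_i$ counts, over all intervals $I_j$ of the set, the endpoints of non-trivial $I_j$ passed over plus the trivial $I_j$ jumped over, and $k_h=\sum_i h_i$. *)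

(* Defs.v *)
From HB Require Import structures.
From mathcomp Require Import all_boot all_order all_algebra.
From mathcomp Require Import boolp.

Set Implicit Arguments.
Unset Strict Implicit.
Unset Printing Implicit Defensive.

Import Order.TTheory GRing.Theory Num.Theory.
Local Open Scope ring_scope.

Inductive uncertain (R : Type) : Type :=
  | Open of R & R
  | Trivial of R.

Definition region (R : realFieldType) (I : uncertain R) : interval R :=
  match I with
  | Open L U => `]L, U[
  | Trivial v => `[v, v]
  end.

Definition lower (R : Type) (I : uncertain R) : R :=
  match I with Open L _ => L | Trivial v => v end.

Definition upper (R : Type) (I : uncertain R) : R :=
  match I with Open _ U => U | Trivial v => v end.

(* [L < U] for open intervals is a consequence of [predictedP]. *)
Record instance (R : realFieldType) (n : nat) := Instance {
  itv : 'I_n -> uncertain R;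
  predicted : 'I_n -> R;
  true_value : 'I_n -> R;
  predictedP : forall i, predicted i \in region (itv i);
  true_valueP : forall i, true_value i \in region (itv i)
}.

(* [v] is a possible value assignment once the queries in [Q] have returned
   the values [w]. *)
Definition consistent (R : realFieldType) (n : nat) (I : 'I_n -> uncertain R)
    (w : 'I_n -> R) (Q : {set 'I_n}) (v : 'I_n -> R) : Prop :=
  (forall i, v i \in region (I i)) /\ (forall i, i \in Q -> v i = w i).

(* The order of the intervals under an assignment [v] is the total preorder
   [v i <= v j]. *)
Definition feasible (R : realFieldType) (n : nat) (I : 'I_n -> uncertain R)
    (w : 'I_n -> R) (Q : {set 'I_n}) : Prop :=
  forall v v', consistent I w Q v -> consistent I w Q v' ->
  forall i j, (v i <= v j) = (v' i <= v' j).

Definition opt (R : realFieldType) (n : nat) (X : instance R n) : nat :=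
  #|[arg min_(Q < [set: 'I_n] | `[< feasible (itv X) (true_value X) Q >]) #|Q|]|.

Lemma feasible_setT (R : realFieldType) (n : nat) (I : 'I_n -> uncertain R)
  (w : 'I_n -> R) : feasible I w [set: 'I_n].
Proof. by move=> v v' [_ vw] [_ v'w] i j; rewrite !vw ?v'w ?in_setT. Qed.

Lemma optP (R : realFieldType) (n : nat) (X : instance R n) :
  (exists2 Q, feasible (itv X) (true_value X) Q & #|Q| = opt X) /\
  (forall Q, feasible (itv X) (true_value X) Q -> (opt X <= #|Q|)%N).
Proof.
rewrite /opt; case: arg_minnP => [|Q /asboolP fQ minQ].
  exact/asboolP/feasible_setT.
by split=> [|Q' /asboolP/minQ//]; exists Q.
Qed.

Definition mandatory (R : realFieldType) (n : nat) (I : 'I_n -> uncertain R)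
    (w : 'I_n -> R) : {set 'I_n} :=
  [set i | `[< forall Q, feasible I w Q -> i \in Q >]].

Definition k_num (R : realFieldType) (n : nat) (X : instance R n) : nat :=
  #|[set i | true_value X i != predicted X i]|.

Definition k_M (R : realFieldType) (n : nat) (X : instance R n) : nat :=
  let IP := mandatory (itv X) (predicted X) in
  let IR := mandatory (itv X) (true_value X) in
  #|(IP :\: IR) :|: (IR :\: IP)|.

Definition passes_lower (R : realFieldType) (x y L : R) : bool :=
  (x <= L) && (L < y) || (y <= L) && (L < x).

Definition passes_upper (R : realFieldType) (x y U : R) : bool :=
  (x < U) && (U <= y) || (y < U) && (U <= x).

Definition jumps_over (R : realFieldType) (x y v : R) : bool :=
  (x < v) && (v < y) || (y < v) && (v < x).

Definition hops (R : realFieldType) (x y : R) (I : uncertain R) : nat :=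
  match I with
  | Open L U => (passes_lower x y L + passes_upper x y U)%N
  | Trivial v => jumps_over x y v
  end.

Definition k_h (R : realFieldType) (n : nat) (X : instance R n) : nat :=
  (\sum_(i < n) \sum_(j < n)
     hops (true_value X i) (predicted X i) (itv X j))%N.

(* Algorithms are finite programs of a random access machine with an oracle
   for queries, so that one program serves all input sizes. Memory consists of
   finitely many named arrays (per program) of naturals and of reals; a scalar
   variable is a cell of an array. Every command and every test costs one unit.
   Naturals can only be added, subtracted and compared: with multiplication the
   unit cost would not be polynomially related to bit cost. Reals can only be
   copied and compared, so that on rational inputs each step also has
   polynomial bit cost. *)

Inductive nexp : Type :=
  | Const of nat
  | Get of nat & nexp              (* array name, index *)
  | Add of nexp & nexp
  | Sub of nexp & nexp.

Inductive test : Type :=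
  | NatLe of nexp & nexp
  | RealLe of nat & nexp & nat & nexp
  | Not of test
  | And of test & test.

Inductive program : Type :=
  | Skip
  | SetNat of nat & nexp & nexp              (* a[e] := e' *)
  | SetReal of nat & nexp & nat & nexp       (* r[e] := r'[e'] *)
  | Query of nexp & nat & nexp               (* r[e'] := true value of e *)
  | Seq of program & program
  | If of test & program & program
  | While of test & program.

(* [queries] lists all queries made so far, with repetitions. *)
Record state (R : Type) (n : nat) := State {
  nats : nat -> nat -> nat;
  reals : nat -> nat -> R;
  queries : seq 'I_n
}.

Definition update (T : Type) (m : nat -> nat -> T) (a i : nat) (x : T)
    (b j : nat) : T :=
  if (b == a) && (j == i) then x else m b j.

Fixpoint neval (m : nat -> nat -> nat) (e : nexp) : nat :=
  match e with
  | Const c => c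
  | Get a e1 => m a (neval m e1)
  | Add e1 e2 => neval m e1 + neval m e2
  | Sub e1 e2 => neval m e1 - neval m e2
  end%N.

Fixpoint teval (R : realFieldType) (n : nat) (s : state R n) (b : test) : bool :=
  match b with
  | NatLe e1 e2 => (neval (nats s) e1 <= neval (nats s) e2)%N
  | RealLe r1 e1 r2 e2 =>
      reals s r1 (neval (nats s) e1) <= reals s r2 (neval (nats s) e2)
  | Not b1 => ~~ teval s b1
  | And b1 b2 => teval s b1 && teval s b2
  end.

(* [exec w P s t s']: when the true values are [w], program [P] started in [s]
   halts in [s'] after [t] steps. The only access to [w] is through [Query];
   a query to an index [>= n] blocks. *)
Inductive exec (R : realFieldType) (n : nat) (w : 'I_n -> R) :
    program -> state R n -> nat -> state R n -> Prop :=
  | exec_skip s : exec w Skip s 1 s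
  | exec_setnat a e1 e2 s :
      exec w (SetNat a e1 e2) s 1
        (State (update (nats s) a (neval (nats s) e1) (neval (nats s) e2))
               (reals s) (queries s))
  | exec_setreal r1 e1 r2 e2 s :
      exec w (SetReal r1 e1 r2 e2) s 1
        (State (nats s)
               (update (reals s) r1 (neval (nats s) e1)
                       (reals s r2 (neval (nats s) e2)))
               (queries s))
  | exec_query e r e' s (i : 'I_n) :
      neval (nats s) e = i ->
      exec w (Query e r e') s 1
        (State (nats s) (update (reals s) r (neval (nats s) e') (w i))
               (i :: queries s))
  | exec_seq P1 P2 s1 s2 s3 t1 t2 :
      exec w P1 s1 t1 s2 -> exec w P2 s2 t2 s3 ->
      exec w (Seq P1 P2) s1 (t1 + t2)%N s3
  | exec_if b P1 P2 s s' t :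
      exec w (if teval s b then P1 else P2) s t s' ->
      exec w (If b P1 P2) s t.+1 s'
  | exec_while_false b P s :
      ~~ teval s b -> exec w (While b P) s 1 s
  | exec_while_true b P s1 s2 s3 t1 t2 :
      teval s1 b -> exec w P s1 t1 s2 -> exec w (While b P) s2 t2 s3 ->
      exec w (While b P) s1 (t1 + t2).+1 s3.

Lemma exec_det (R : realFieldType) (n : nat) (w : 'I_n -> R) P s t1 s1 t2 s2 :
  exec w P s t1 s1 -> exec w P s t2 s2 -> t1 = t2 /\ s1 = s2.
Proof.
move=> e1; elim: e1 t2 s2 => {P s t1 s1}.
- by move=> s t2 s2 e2; inversion e2.
- by move=> a e e' s t2 s2 e2; inversion e2.
- by move=> r e r' e' s t2 s2 e2; inversion e2.
- move=> e r e' s i ei t2 s2 e2; inversion e2 as [| | |? ? ? ? j ej| | | |]; subst.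
  by have -> : i = j by apply: val_inj; rewrite /= -ei -ej.
- move=> P1 P2 s1 s2 s3 t1 t2 _ IH1 _ IH2 t s e2; inversion e2 as
    [| | | |? ? ? ? ? ? ? h1 h2| | |]; subst.
  by case: (IH1 _ _ h1) => ? ?; subst; case: (IH2 _ _ h2) => ? ?; subst.
- move=> b P1 P2 s s' t _ IH t2 s2 e2; inversion e2 as
    [| | | | |? ? ? ? ? ? h| |]; subst.
  by case: (IH _ _ h) => -> ->.
- move=> b P s nb t2 s2 e2; inversion e2 as
    [| | | | | | |? ? ? ? ? ? ? hb]; subst => //.
  by rewrite hb in nb.
- move=> b P s1 s2 s3 t1 t2 hb _ IH1 _ IH2 t s e2; inversion e2 as
    [| | | | | |? ? ? nb|? ? ? ? ? ? ? _ h1 h2]; subst.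
    by rewrite hb in nb.
  by case: (IH1 _ _ h1) => ? ?; subst; case: (IH2 _ _ h2) => ? ?; subst.
Qed.

(* Value of [f] at index [k], and [d] beyond the range. *)
Definition cell (T : Type) (n : nat) (d : T) (f : 'I_n -> T) (k : nat) : T :=
  if insub k is Some i then f i else d.

(* Input: [n] is in nat array 0, cell 0; the lower endpoints, upper endpoints
   and predicted values are in real arrays 0, 1 and 2. A trivial interval has
   equal endpoints. All other cells are 0. *)
Definition init (R : realFieldType) (n : nat) (X : instance R n) : state R n :=
  State
    (fun a k => if (a == 0) && (k == 0) then n else 0)%N
    (fun r => match r with
              | 0 => cell 0 (fun i => lower (itv X i))
              | 1 => cell 0 (fun i => upper (itv X i))
              | 2 => cell 0 (predicted X)
              | _ => fun=> 0
              end)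
    [::].

(* Output: nat array 1 ranks the intervals by true value. *)
Definition outputs_order (R : realFieldType) (n : nat) (X : instance R n)
    (s : state R n) : Prop :=
  forall i j : 'I_n,
    (nats s 1 i <= nats s 1 j)%N = (true_value X i <= true_value X j).

(* Main.v *)
Require Import Defs.
From mathcomp Require Import all_boot all_order all_algebra.
From mathcomp Require Import boolp lra zify.

(* A query set is feasible iff it contains every interval that strictly contains
   the true value of another one (the mandatory intervals) and it covers the
   overlap graph of the non-trivial intervals. The algorithm first queries all
   prediction mandatory intervals and everything that the answers make mandatory
   (a set [B]), then a minimum vertex cover [C] of the overlap graph outside [B],
   and finally everything that has become mandatory.

   Among three pairwise overlapping intervals without inclusions, the prediction
   of the middle one lies in one of the other two; hence the graph outside [B]
   is a union of paths, along consecutive intervals in left-endpoint order.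
   Every query outside an optimal set is due to a wrong prediction. Such a
   prediction is charged only once, except that a vertex of [C] may both have a
   wrong prediction that triggered a superfluous query and reveal a value that
   triggers a late one; it is then an end of its path and the optimum contains
   both ends of its edge in a matching that certifies the optimality of [C].

   For the factor 2, consider the components of the overlap graph of the
   intervals that contain no other non-trivial interval. Consecutive intervals
   of a component overlap, so the optimum contains half of them, rounded down,
   and only an entirely queried component with 2q + 1 vertices whose q even
   positions are its intersection with the optimum is critical. [C] prefers even
   positions, which forces all q + 1 odd positions to be prediction mandatory;
   they are triggered by distinct predictions, one of which must belong to an
   interval with another one inside, and the latter pays for the excess. *)

Set Implicit Arguments.
Unset Strict Implicit.
Unset Printing Implicit Defensive.

Import Order.TTheory GRing.Theory Num.Theory.
Local Open Scope ring_scope.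

(** * Feasible query sets *)

(** Unlike [region], this is empty for a trivial interval, so an interval with a value strictly
    inside is automatically non-trivial. *)
Definition inside (R : realFieldType) (I : uncertain R) (x : R) : bool :=
  (lower I < x) && (x < upper I).

Definition nontrivial (R : realFieldType) (I : uncertain R) : bool :=
  lower I < upper I.

Lemma region_nontrivial (R : realFieldType) (I : uncertain R) x :
  nontrivial I -> (x \in region I) = inside I x.
Proof. by case: I => [l u|v]; rewrite /nontrivial /inside ?ltxx //= in_itv. Qed.

Lemma region_trivial (R : realFieldType) (I : uncertain R) x y :
  y \in region I -> ~~ nontrivial I -> x \in region I -> x = lower I.
Proof.
case: I => [l u|v]; rewrite /nontrivial /= !in_itv /=.
  by move=> /andP[/lt_trans h /h ->].
by move=> _ _; rewrite andbC -eq_le => /eqP.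
Qed.

Section Feasibility.
Variables (R : realFieldType) (n : nat) (I : 'I_n -> uncertain R).
Variable w : 'I_n -> R.
Hypothesis wP : forall i, w i \in region (I i).

Definition overlap (i j : 'I_n) : bool :=
  (lower (I i) < upper (I j)) && (lower (I j) < upper (I i)).

Definition value_mandatory : {set 'I_n} :=
  [set i | [exists j, (j != i) && inside (I i) (w j)]].

Definition covers_overlaps (Q : {set 'I_n}) : Prop :=
  forall i j, i != j -> nontrivial (I i) -> nontrivial (I j) -> overlap i j ->
  (i \in Q) || (j \in Q).

Lemma consistent_with_value (Q : {set 'I_n}) v i x :
  consistent I w Q v -> i \notin Q -> x \in region (I i) ->
  consistent I w Q (fun j => if j == i then x else v j).
Proof.
move=> [vI vQ] iQ xI; split=> j; case: eqP => [->|_] //.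
  by rewrite (negbTE iQ).
exact: vQ.
Qed.

Lemma consistent_true (Q : {set 'I_n}) : consistent I w Q w.
Proof. by []. Qed.

(** Necessity: an unqueried interval can place its value on either side of a value inside it, and
    two unqueried overlapping intervals can swap theirs. Sufficiency: no other true value lies
    strictly inside an unqueried non-trivial interval, so its endpoints decide every comparison with
    a known value, and two unqueried non-trivial intervals are disjoint. *)
Lemma feasibleP (Q : {set 'I_n}) :
  feasible I w Q <-> value_mandatory \subset Q /\ covers_overlaps Q.
Proof.
split=> [fQ|[mQ cQ]].
  split.
    apply/subsetP=> i; rewrite inE => /existsP[j /andP[ji /andP[lo hi]]].
    apply/negPn/negP=> iQ.
    have nt : nontrivial (I i) by exact: lt_trans lo hi.
    pose x := (lower (I i) + w j) / 2; pose y := (w j + upper (I i)) / 2.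
    have xI : x \in region (I i).
      by rewrite region_nontrivial // /inside /x; apply/andP; split; lra.
    have yI : y \in region (I i).
      by rewrite region_nontrivial // /inside /y; apply/andP; split; lra.
    have := fQ _ _ (consistent_with_value (consistent_true Q) iQ xI)
                   (consistent_with_value (consistent_true Q) iQ yI) i j.
    rewrite eqxx (negbTE ji) /x /y.
    have -> : ((lower (I i) + w j) / 2 <= w j) by lra.
    by move/esym; apply/negP; rewrite -ltNge; lra.
  move=> i j ij nti ntj /andP[o1 o2]; apply/negPn/negP; rewrite negb_or.
  move=> /andP[iQ jQ].
  rewrite /nontrivial in nti ntj.
  have [x [y [xy xi xj yi yj]]] : exists x y, [/\ x < y, inside (I i) x,
      inside (I j) x, inside (I i) y & inside (I j) y].
    pose lo := Num.max (lower (I i)) (lower (I j)).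
    pose hi := Num.min (upper (I i)) (upper (I j)).
    have lohi : lo < hi by rewrite /lo /hi gt_max !lt_min nti ntj o1 o2.
    have l1 : lower (I i) <= lo by rewrite /lo le_max lexx.
    have l2 : lower (I j) <= lo by rewrite /lo le_max lexx orbT.
    have h1 : hi <= upper (I i) by rewrite /hi ge_min lexx.
    have h2 : hi <= upper (I j) by rewrite /hi ge_min lexx orbT.
    (* The points at the thirds of the common part can be assigned to the two intervals in either
       order. *)
    exists ((2 * lo + hi) / 3), ((lo + 2 * hi) / 3); rewrite /inside.
    by split; [|apply/andP; split..]; lra.
  have cons a b : inside (I i) a -> inside (I j) b ->
      consistent I w Q (fun k => if k == j then b
                                 else if k == i then a else w k).
    move=> ai bj; apply: consistent_with_value => //; last first.
      by rewrite region_nontrivial.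
    by apply: consistent_with_value => //; rewrite region_nontrivial.
  have := fQ _ _ (cons _ _ xi yj) (cons _ _ yi xj) i j.
  by rewrite !eqxx (negbTE ij) (ltW xy) leNgt xy.
have mem i j : i != j -> inside (I i) (w j) -> i \in Q.
  move=> ij h; apply: (subsetP mQ); rewrite inE; apply/existsP; exists j.
  by rewrite eq_sym ij.
have cell v i : consistent I w Q v -> i \in Q \/ ~~ nontrivial (I i) ->
    v i = w i.
  move=> [vI vQ] [/vQ//|nt].
  by rewrite (region_trivial (wP i) nt (vI i)) (region_trivial (wP i) nt (wP i)).
have side v i j : consistent I w Q v -> i \notin Q -> nontrivial (I i) ->
    j != i -> (w j <= v i) = (w j <= lower (I i)) /\
              (v i <= w j) = (upper (I i) <= w j).
  move=> [vI vQ] iQ nt ji.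
  have := vI i; rewrite region_nontrivial // => /andP[lo hi].
  have : ~~ inside (I i) (w j).
    by apply: contra iQ => h; apply: mem h; rewrite eq_sym.
  rewrite /inside negb_and -!leNgt => /orP[h|h]; split.
  - by rewrite h (le_trans h (ltW lo)).
  - rewrite [LHS]leNgt [RHS]leNgt (le_lt_trans h lo).
    by rewrite (le_lt_trans h nt).
  - rewrite [LHS]leNgt [RHS]leNgt (lt_le_trans hi h).
    by rewrite (lt_le_trans nt h).
  - by rewrite h (le_trans (ltW hi) h).
move=> v v' cv cv' i j.
have [->|ij] := eqVneq i j; first by rewrite !lexx.
have dec k : {k \in Q \/ ~~ nontrivial (I k)} +
             {k \notin Q /\ nontrivial (I k)}.
  by case: (k \in Q); case: (nontrivial (I k)); constructor; auto.
have [ki|[iQ nti]] := dec i; have [kj|[jQ ntj]] := dec j.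
- by rewrite !(cell v) // !(cell v').
- rewrite (cell v i) // (cell v' i) //.
  by rewrite (side v j i cv jQ ntj ij).1 (side v' j i cv' jQ ntj ij).1.
- rewrite (cell v j) // (cell v' j) // eq_sym in ij *.
  by rewrite (side v i j cv iQ nti ij).2 (side v' i j cv' iQ nti ij).2.
have : ~~ overlap i j.
  by apply/negP=> /(cQ i j ij nti ntj); rewrite (negbTE iQ) (negbTE jQ).
have bnd u k : consistent I w Q u -> nontrivial (I k) ->
    lower (I k) < u k < upper (I k).
  by move=> [uI _] nt; have := uI k; rewrite region_nontrivial.
have /andP[a1 a2] := bnd v i cv nti; have /andP[a3 a4] := bnd v j cv ntj.
have /andP[b1 b2] := bnd v' i cv' nti; have /andP[b3 b4] := bnd v' j cv' ntj.
rewrite /overlap negb_and -!leNgt => /orP[h|h].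
  rewrite [LHS]leNgt [RHS]leNgt (lt_trans (lt_le_trans a4 h) a1).
  by rewrite (lt_trans (lt_le_trans b4 h) b1).
rewrite (ltW (lt_trans (lt_le_trans a2 h) a3)).
by rewrite (ltW (lt_trans (lt_le_trans b2 h) b3)).
Qed.

(** If no other true value lies inside [I i], then querying everything except [i] is feasible: a
    single missing vertex leaves no overlap uncovered. *)
Lemma mandatoryE : mandatory I w = value_mandatory.
Proof.
apply/setP=> i; rewrite [LHS]inE; apply/asboolP/idP; last first.
  by move=> iM Q /feasibleP[/subsetP/(_ i iM)].
move=> iQ; apply/negPn/negP=> iM; have := iQ [set~ i].
rewrite !inE eqxx /= => h; suff /h : feasible I w [set~ i] by [].
apply/feasibleP; split.
  by apply/subsetP=> j jM; rewrite !inE; apply: contraNneq iM => <-.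
move=> j k jk _ _ _; rewrite !inE -negb_and; apply: contra jk.
by move=> /andP[/eqP-> /eqP->].
Qed.

End Feasibility.

(** * Counting queries *)

(** Inclusion is weak here, so two equal intervals disqualify each other. This is what makes the
    endpoints of innermost intervals strictly ordered. *)
Definition innermost (R : realFieldType) (n : nat) (I : 'I_n -> uncertain R)
    (i : 'I_n) : bool :=
  nontrivial (I i) &&
  ~~ [exists j, [&& j != i, nontrivial (I j), lower (I i) <= lower (I j)
                  & upper (I j) <= upper (I i)]].

(** The pairs of positions [2s] and [2s + 1] form a perfect matching of the path. *)
Lemma matched_count (g : nat -> bool) q :
  (forall t, (t.+1 < q.*2)%N -> g t || g t.+1) ->
  (q <= \sum_(0 <= t < q.*2) g t)%N.
Proof.
elim: q => [|q IH] h; first by rewrite big_geq.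
rewrite doubleS !big_nat_recr //= -addnA.
have /IH : forall t, (t.+1 < q.*2)%N -> g t || g t.+1.
  by move=> t tq; apply: h; rewrite doubleS; exact: leqW (leqW tq).
have : g q.*2 || g q.*2.+1 by apply: h; rewrite doubleS.
by case: (g q.*2); case: (g q.*2.+1) => //=; clear; lia.
Qed.

(** One of the last two positions is chosen, so the path without them is tight as well and by
    induction omits its last position. This forces the next position and exhausts the budget. *)
Lemma tight_odd_path_cover (g : nat -> bool) q :
  (forall t, (t < q.*2)%N -> g t || g t.+1) ->
  (\sum_(0 <= t < q.*2.+1) g t <= q)%N ->
  forall t, (t <= q.*2)%N -> g t = odd t.
Proof.
elim: q => [|q IH] h.
  rewrite big_nat1 => h0 t; rewrite leqn0 => /eqP->.
  by move: h0; case: (g 0%N).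
have hq t : (t < q.*2)%N -> g t || g t.+1.
  by move=> tq; apply: h; rewrite doubleS; exact: leqW (ltnW tq).
have low := matched_count (fun t tq => hq t (ltnW tq)).
have p1 : g q.*2 || g q.*2.+1 by apply: h; rewrite doubleS.
have p2 : g q.*2.+1 || g q.*2.+2 by apply: h; rewrite doubleS.
rewrite doubleS !big_nat_recr //= => tot.
have qs : (\sum_(0 <= t < q.*2.+1) g t <= q)%N.
  rewrite big_nat_recr //=; move: tot p2.
  by case: (g q.*2.+1); case: (g q.*2.+2) => //=; clear; lia.
have gq := IH hq qs _ (leqnn _).
rewrite odd_double in gq; rewrite gq /= in p1.
have g2 : g q.*2.+2 = false.
  by move: tot; rewrite p1 gq; move: low; case: (g q.*2.+2) => //=; clear; lia.
move=> t; rewrite leq_eqVlt ltnS leq_eqVlt ltnS => /or3P[/eqP->|/eqP->|tq].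
- by rewrite g2 /= odd_double.
- by rewrite p1 /= odd_double.
- exact: IH.
Qed.

Section Analysis.
Variables (R : realFieldType) (n : nat) (I : 'I_n -> uncertain R).
Variables (w p : 'I_n -> R).
Hypothesis wP : forall i, w i \in region (I i).
Hypothesis pP : forall i, p i \in region (I i).

Let lo i := lower (I i).
Let hi i := upper (I i).
Let M := value_mandatory I w.
Let IP := value_mandatory I p.

Lemma value_inside v i : (forall j, v j \in region (I j)) ->
  nontrivial (I i) -> lo i < v i /\ v i < hi i.
Proof. by move=> vP nt; have := vP i; rewrite region_nontrivial // => /andP. Qed.

Lemma insideP i x : inside (I i) x -> lo i < x /\ x < hi i.
Proof. by move/andP. Qed.

Lemma inside_nontrivial i x : inside (I i) x -> nontrivial (I i).
Proof. by move=> /andP[]; exact: lt_trans. Qed.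

Lemma value_mandatoryP v i :
  reflect (exists2 j, j != i & inside (I i) (v j)) (i \in value_mandatory I v).
Proof.
rewrite inE; apply: (iffP existsP) => [[j /andP[]]|[j ji h]]; exists j => //.
by rewrite ji.
Qed.

Lemma mandatory_nontrivial v i : i \in value_mandatory I v -> nontrivial (I i).
Proof. by move=> /value_mandatoryP[j _ /inside_nontrivial]. Qed.

Lemma innermost_nontrivial i : innermost I i -> nontrivial (I i).
Proof. by case/andP. Qed.

(** Whatever the values are, that of the nested non-trivial interval lies inside the outer one, so
    this serves predictions and true values alike. *)
Lemma nested_mandatory v i : (forall j, v j \in region (I j)) ->
  nontrivial (I i) -> ~~ innermost I i -> i \in value_mandatory I v.
Proof.
move=> vP nt; rewrite /innermost nt negbK => /existsP[j /and4P[ji ntj h1 h2]].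
apply/value_mandatoryP; exists j => //; have [h3 h4] := value_inside vP ntj.
by rewrite /inside (le_lt_trans h1 h3) (lt_le_trans h4 h2).
Qed.

Lemma common_value_overlap i j x :
  inside (I i) x -> inside (I j) x -> overlap I i j.
Proof.
by move=> /andP[a b] /andP[c d]; rewrite /overlap (lt_trans a d) (lt_trans c b).
Qed.

Lemma inside_value_overlap v i j : (forall k, v k \in region (I k)) ->
  nontrivial (I j) -> inside (I i) (v j) -> overlap I i j.
Proof.
move=> vP nt h; apply: common_value_overlap h _.
by rewrite /inside; have [-> ->] := value_inside vP nt.
Qed.

Lemma overlapC i j : overlap I i j = overlap I j i.
Proof. by rewrite /overlap andbC. Qed.

Variable OPT : {set 'I_n}.
Hypothesis OPT_M : M \subset OPT.
Hypothesis OPT_cover : covers_overlaps I OPT.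

Lemma not_OPT_eq i j : nontrivial (I i) -> nontrivial (I j) ->
  i \notin OPT -> j \notin OPT -> overlap I i j -> i = j.
Proof.
move=> nti ntj io jo ov; apply/eqP/negPn/negP=> ij.
by have := OPT_cover ij nti ntj ov; rewrite (negbTE io) (negbTE jo).
Qed.

(** * The innermost intervals in the order of their left endpoints *)

Variables (m : nat) (x : nat -> 'I_n).
Hypothesis x_in : forall k, (k < m)%N -> innermost I (x k).
Hypothesis x_onto : forall i, innermost I i -> exists2 k, (k < m)%N & x k = i.
Hypothesis x_lt : forall k l, (k < l < m)%N -> lo (x k) < lo (x l).

Lemma x_inj k l : (k < m)%N -> (l < m)%N -> x k = x l -> k = l.
Proof.
move=> km lm e; case: (ltngtP k l) => // h.
  have /x_lt : (k < l < m)%N by rewrite h.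
  by rewrite e ltxx.
have /x_lt : (l < k < m)%N by rewrite h.
by rewrite e ltxx.
Qed.

Lemma x_hi k l : (k < l < m)%N -> hi (x k) < hi (x l).
Proof.
move=> klm; have h := x_lt klm; rewrite ltNge; apply/negP=> h'.
case/andP: klm => kl lm; have km := ltn_trans kl lm.
have /andP[_ /negP[]] := x_in km; apply/existsP; exists (x l).
rewrite (ltW h) h' (innermost_nontrivial (x_in lm)) !andbT.
by apply: contraTneq h => ->; rewrite ltxx.
Qed.

Lemma x_nontrivial k : (k < m)%N -> nontrivial (I (x k)).
Proof. by move/x_in/innermost_nontrivial. Qed.

(* The prediction of an interval lying between two overlapping ones falls into
   one of them, hence makes it prediction mandatory. *)
Lemma overlap_outside_IP_consecutive k l : (k < l < m)%N ->
  x k \notin IP -> x l \notin IP -> lo (x l) < hi (x k) -> l = k.+1.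
Proof.
move=> /andP[kl lm] kP lP ov; apply/eqP; rewrite eqn_leq kl andbT leqNgt.
apply/negP=> kl2; have k1m := ltn_trans kl2 lm.
have [h1 h2] := value_inside pP (x_nontrivial k1m).
have l1 : lo (x k) < lo (x k.+1) by apply: x_lt; rewrite leqnn.
have l3 : hi (x k.+1) < hi (x l) by apply: x_hi; rewrite kl2.
have kk1 : x k.+1 != x k by apply: contraTneq l1 => ->; rewrite ltxx.
have k1l : x k.+1 != x l by apply: contraTneq l3 => ->; rewrite ltxx.
have [c|c] := ltP (p (x k.+1)) (hi (x k)).
  move/negP: kP; apply; apply/value_mandatoryP; exists (x k.+1) => //.
  by rewrite /inside (lt_trans l1 h1).
move/negP: lP; apply; apply/value_mandatoryP; exists (x k.+1) => //.
by rewrite /inside (lt_trans h2 l3) andbT; exact: lt_le_trans ov c.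
Qed.

(** An edge is indexed by its right end. Thus [adj 0] and [adj m] are false, and [~~ adj k] marks a
    boundary between components. *)
Definition adj k := (0 < k < m)%N && (lo (x k) < hi (x k.-1)).

Lemma adj_overlap k : adj k -> overlap I (x k.-1) (x k).
Proof.
case: k => [|k] /andP[/andP[// _ km] h]; rewrite /overlap /= [X in _ && X]h.
rewrite andbT; have [h1 h2] := value_inside pP (x_nontrivial km).
by apply: lt_trans (lt_trans h1 h2); apply: x_lt; rewrite leqnn.
Qed.

(** Outside [IP] every non-trivial interval is innermost by [nested_mandatory], and only neighbours
    in the order overlap, so the overlap graph there is a union of paths. *)
Lemma overlap_outside_IP_adj i j : i != j ->
  nontrivial (I i) -> nontrivial (I j) -> i \notin IP -> j \notin IP ->
  overlap I i j ->
  exists k, adj k.+1 /\ ((i = x k /\ j = x k.+1) \/ (j = x k /\ i = x k.+1)).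
Proof.
move=> ij nti ntj iP jP /andP[o1 o2].
have inn y : nontrivial (I y) -> y \notin IP -> innermost I y.
  by move=> nt; apply: contraNT; exact: nested_mandatory.
have [k km ek] := x_onto (inn _ nti iP); have [l lm el] := x_onto (inn _ ntj jP).
case: (ltngtP k l) => [kl|lk|kl]; last by rewrite -ek -el kl eqxx in ij.
- have h : l = k.+1.
    by apply: overlap_outside_IP_consecutive; rewrite ?kl ?ek ?el.
  rewrite h in lm el.
  by exists k; split; [rewrite /adj lm /= el ek|left].
- have h : k = l.+1.
    by apply: overlap_outside_IP_consecutive; rewrite ?lk ?ek ?el.
  rewrite h in km ek.
  by exists l; split; [rewrite /adj km /= el ek|right].
Qed.

(** * The paths outside the first closure and their vertex cover *)

Variable B : {set 'I_n}.
Hypothesis IP_B : IP \subset B.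
Hypothesis B_sub : B \subset IP :|: M.
Hypothesis B_closed : forall i j, i != j -> j \in B -> inside (I i) (w j) ->
  i \in B.

Lemma notB_notIP i : i \notin B -> i \notin IP.
Proof. by apply: contra; exact: (subsetP IP_B). Qed.

Definition link k := [&& adj k, x k.-1 \notin B & x k \notin B].

(* [mark] selects the even positions of each component; [sp k] and [ep k] are the
   marks of the first and last vertex of the path through [k] outside [B]. *)
Variables mark sp ep : nat -> bool.
Hypothesis markE : forall k, (k < m)%N -> mark k = adj k && ~~ mark k.-1.
Hypothesis spE : forall k, (k < m)%N -> sp k = if link k then sp k.-1 else mark k.
Hypothesis epE : forall k, (k < m)%N ->
  ep k = if link k.+1 then ep k.+1 else mark k.
Variable C : {set 'I_n}.
Hypothesis C_in : forall i, i \in C -> innermost I i.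
(** Here [&&] binds tighter than [!=]. [C] takes the marked vertices of a path unless both ends are
    marked, in which case the unmarked ones are one fewer. An isolated vertex is never taken. *)
Hypothesis CE : forall k, (k < m)%N ->
  (x k \in C) = (x k \notin B) && (mark k != sp k && ep k).

Lemma adj_lt k : adj k -> [/\ (0 < k)%N, (k < m)%N & (k.-1 < m)%N].
Proof. by case/andP=> /andP[h1 h2] _; split=> //; case: k h1 h2 => // k _ /ltnW. Qed.

Lemma link_lt k : link k -> [/\ (0 < k)%N, (k < m)%N & (k.-1 < m)%N].
Proof. by case/and3P=> /adj_lt. Qed.

Lemma link_mark k : link k -> mark k = ~~ mark k.-1.
Proof. by move=> lk; have [? ? ?] := link_lt lk; rewrite markE //; case/and3P: lk => ->. Qed.

Lemma link_sp k : link k -> sp k = sp k.-1.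
Proof. by move=> lk; have [? ? ?] := link_lt lk; rewrite spE // lk. Qed.

Lemma link_ep k : link k -> ep k.-1 = ep k.
Proof.
by move=> lk; have [k0 ? ?] := link_lt lk; rewrite epE // prednK // lk.
Qed.

Lemma link_C k : link k -> (x k \in C) = (x k.-1 \notin C).
Proof.
move=> lk; have [k0 km k1m] := link_lt lk; rewrite !CE //.
rewrite (link_mark lk) (link_sp lk) -(link_ep lk).
case/and3P: lk => _ -> ->.
by case: (mark _); case: (sp _); case: (ep _).
Qed.

Lemma notB_overlap_C i j : i != j ->
  nontrivial (I i) -> nontrivial (I j) -> i \notin B -> j \notin B ->
  overlap I i j -> (i \in C) = (j \notin C).
Proof.
move=> ij nti ntj iB jB ov.
have [k [ak e]] := overlap_outside_IP_adj ij nti ntj (notB_notIP iB) (notB_notIP jB) ov.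
have lk : link k.+1.
  by rewrite /link ak /=; case: e => -[ei ej]; rewrite -ei -ej iB jB.
have := link_C lk; rewrite /=.
by case: e => -[-> ->] => ->; rewrite ?negbK.
Qed.

(** Matches a vertex of [C] with a neighbour outside [C]. An unmarked vertex of [C] is interior and
    goes left. A marked one goes left if its path starts unmarked, since it is then not the first,
    and right otherwise, since the path then ends unmarked. The direction is constant along a
    path. *)
Definition mate_pos k := if ~~ mark k || ~~ sp k then k.-1 else k.+1.

Lemma mate_posP k : (k < m)%N -> x k \in C ->
  (mate_pos k = k.-1 /\ link k) \/ (mate_pos k = k.+1 /\ link k.+1).
Proof.
move=> km; rewrite CE // /mate_pos => /andP[kB].
have := spE km; have := epE km.
by case lk: (link k); case lk1 : (link k.+1); case: (mark k); case: (sp k);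
  case: (ep k) => //= *; auto.
Qed.

(** Two vertices sharing a mate would be [k] and [k + 2] on one path, matched in opposite directions
    although they agree in [mark] and [sp]. *)
Lemma mate_pos_inj k l : (k < m)%N -> (l < m)%N -> x k \in C -> x l \in C ->
  mate_pos k = mate_pos l -> k = l.
Proof.
wlog kl : k l / (k <= l)%N.
  move=> h km lm kC lC e; case: (leqP k l) => [|/ltnW] kl; first exact: h.
  by apply/esym/h.
move=> km lm kC lC e.
case: (mate_posP km kC) => -[ek lk]; case: (mate_posP lm lC) => -[el ll].
- have [k0 _ _] := link_lt lk; have [l0 _ _] := link_lt ll.
  by rewrite ek el in e; rewrite -(prednK k0) -(prednK l0) e.
- by move: kl e; rewrite ek el; clear; lia.
- have e2 : l = k.+2.
    by have [+ _ _] := link_lt ll; move: e; rewrite ek el; clear; lia.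
  rewrite e2 in ll el.
  have m1 := link_mark lk; have m2 := link_mark ll.
  have s1 := link_sp lk; have s2 := link_sp ll; rewrite /= in m1 m2 s1 s2.
  move: ek el; rewrite /mate_pos m2 s2 m1 s1 negbK.
  by case: ifP => _ //; clear; lia.
- by move: e; rewrite ek el => -[].
Qed.

Definition mate (i : 'I_n) : 'I_n :=
  if [pick k : 'I_m | x k == i] is Some k then x (mate_pos k) else i.

Lemma mateE k : (k < m)%N -> mate (x k) = x (mate_pos k).
Proof.
move=> km; rewrite /mate; case: pickP => [l /eqP e|/(_ (Ordinal km))/=].
  by rewrite (x_inj (ltn_ord l) km e).
by rewrite eqxx.
Qed.

Lemma mateP i : i \in C ->
  [/\ mate i \notin B, mate i \notin C, nontrivial (I (mate i)), mate i != i
    & overlap I i (mate i)].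
Proof.
move=> iC; have [k km e] := x_onto (C_in iC); rewrite -e in iC *; rewrite mateE //.
case: (mate_posP km iC) => -[-> lk]; have [k0 lm l1m] := link_lt lk;
  have /and3P[ak b1 b2] := lk; have ov := adj_overlap ak; have h := link_C lk.
- split=> //; first by rewrite -h.
  + exact: x_nontrivial.
  + by apply/eqP=> /x_inj e'; have := e' l1m lm; move: k0; clear; lia.
  + by rewrite overlapC.
- split=> //; first by rewrite h /= negbK.
  + exact: x_nontrivial.
  + by apply/eqP=> /x_inj e'; have := e' lm l1m; clear; lia.
Qed.

Lemma mate_inj : {in C &, injective mate}.
Proof.
move=> i j iC jC.
have [k km ei] := x_onto (C_in iC); have [l lm ej] := x_onto (C_in jC).
rewrite -ei -ej in iC jC *; rewrite !mateE // => e; congr x.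
apply: mate_pos_inj => //; apply: x_inj e.
  by case: (mate_posP km iC) => -[-> /link_lt[]].
by case: (mate_posP lm jC) => -[-> /link_lt[]].
Qed.

(* The prediction of an inner vertex of a path lies in the gap between its two
   neighbours. *)
Lemma two_neighbours_predicted_outside j a b y :
  [/\ nontrivial (I j), nontrivial (I a) & nontrivial (I b)] ->
  [/\ j \notin B, a \notin B & b \notin B] -> a != b -> a != j -> b != j ->
  overlap I a j -> overlap I b j -> innermost I y -> y != j ->
  ~~ inside (I y) (p j).
Proof.
move=> [ntj nta ntb] [jB aB bB] ab aj bj ova ovb yin yj.
have [k [ej kB k2B km]] : exists k,
    [/\ j = x k.+1, x k \notin B, x k.+2 \notin B & (k.+2 < m)%N].
  have [k [ak ek]] := overlap_outside_IP_adj aj nta ntj (notB_notIP aB) (notB_notIP jB) ova.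
  have [l [al el]] := overlap_outside_IP_adj bj ntb ntj (notB_notIP bB) (notB_notIP jB) ovb.
  have [_ kl1 kl2] := adj_lt ak; have [_ ll1 ll2] := adj_lt al.
  rewrite /= in kl2 ll2.
  case: ek => -[e1 e2]; case: el => -[e3 e4].
  - move: ab; rewrite e1 e3; have := x_inj kl1 ll1; rewrite -e2 -e4 => /(_ erefl)[->].
    by rewrite eqxx.
  - have e : k.+1 = l by apply: x_inj => //; rewrite -e2.
    by subst l; exists k; rewrite -e1 -e2 -e4.
  - have e : l.+1 = k by apply: x_inj => //; rewrite -e4.
    by subst k; exists l; rewrite -e3 -e4 -e2.
  - move: ab; rewrite e2 e4; have := x_inj kl2 ll2; rewrite -e1 -e3 => /(_ erefl)->.
    by rewrite eqxx.
have k1m := ltnW km; have k0m := ltnW k1m.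
have [l lm ey] := x_onto yin; rewrite {j ntj jB aj bj ova ovb}ej -{y yin}ey in yj *.
have [h1 h2] := value_inside pP (x_nontrivial k1m).
have lk : lo (x k) < lo (x k.+1) by apply: x_lt; rewrite leqnn.
have hk : hi (x k.+1) < hi (x k.+2) by apply: x_hi; rewrite leqnn.
have g1 : hi (x k) <= p (x k.+1).
  rewrite leNgt; apply/negP=> h; move/negP: (notB_notIP kB); apply.
  apply/value_mandatoryP; exists (x k.+1).
    by apply: contraTneq lk => ->; rewrite ltxx.
  by rewrite /inside (lt_trans lk h1).
have g2 : p (x k.+1) <= lo (x k.+2).
  rewrite leNgt; apply/negP=> h; move/negP: (notB_notIP k2B); apply.
  apply/value_mandatoryP; exists (x k.+1).
    by apply: contraTneq hk => ->; rewrite ltxx.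
  by rewrite /inside (lt_trans h2 hk) andbT.
apply/negP=> /insideP[i1 i2].
have : (l <= k)%N || (k.+2 <= l)%N.
  have : l != k.+1 by apply: contra yj => /eqP->.
  by rewrite neq_ltn ltnS => /orP[] ->; rewrite ?orbT.
case/orP; rewrite leq_eqVlt => /orP[/eqP e|h].
- by rewrite e ltNge g1 in i2.
- have : hi (x l) < hi (x k) by apply: x_hi; rewrite h.
  by move=> /(lt_trans i2); rewrite ltNge g1.
- by rewrite -e ltNge g2 in i1.
- have : lo (x k.+2) < lo (x l) by apply: x_lt; rewrite h.
  by move=> /lt_trans /(_ i1); rewrite ltNge g2.
Qed.

(** * Late queries and feasibility of the final query set *)

Variable A : {set 'I_n}.
Hypothesis BA : B \subset A.
Hypothesis CA : C \subset A.
Hypothesis A_wit : forall i, i \in A -> i \notin B -> i \notin C ->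
  exists j, [/\ j \in A, j != i & inside (I i) (w j)].
Hypothesis A_closed : forall i j, i != j -> j \in A -> inside (I i) (w j) ->
  i \in A.

Lemma C_notB i : i \in C -> i \notin B.
Proof.
by move=> iC; have [k km e] := x_onto (C_in iC); move: iC; rewrite -e CE // => /andP[].
Qed.

(** A witness in [B] would have put [i] into [B]. A witness that is itself late would overlap [i]
    with both outside [B] and outside the cover [C]. *)
Lemma late_witness i : i \in A -> i \notin B -> i \notin C ->
  exists2 j, j \in C & inside (I i) (w j).
Proof.
move=> iA iB iC; have [j [jA ji h]] := A_wit iA iB iC.
have [jC|jC] := boolP (j \in C); first by exists j.
have jB : j \notin B.
  by apply: contra iB => jB; apply: B_closed h; rewrite // eq_sym.
have [k [_ _ hk]] := A_wit jA jB jC.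
have ntj := inside_nontrivial hk; have nti := inside_nontrivial h.
have ov := inside_value_overlap wP ntj h.
rewrite eq_sym in ji.
by have := notB_overlap_C ji nti ntj iB jB ov; rewrite (negbTE iC) jC.
Qed.

Lemma late_M i : i \in A -> i \notin B -> i \notin C -> i \in M.
Proof. by move=> iA iB iC; have [j [_ ? ?]] := A_wit iA iB iC; apply/value_mandatoryP; exists j. Qed.

Lemma A_sub_nontrivial i : i \in A -> nontrivial (I i).
Proof.
move=> iA; have [/(subsetP B_sub)|iB] := boolP (i \in B).
  by rewrite inE => /orP[] /mandatory_nontrivial.
have [/C_in/innermost_nontrivial//|iC] := boolP (i \in C).
by have := late_M iA iB iC => /mandatory_nontrivial.
Qed.

Lemma A_covers : covers_overlaps I A.
Proof.
move=> i j ij nti ntj ov; apply/negPn/negP; rewrite negb_or => /andP[iA jA].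
have iB : i \notin B by apply: contra iA; exact: (subsetP BA).
have jB : j \notin B by apply: contra jA; exact: (subsetP BA).
have := notB_overlap_C ij nti ntj iB jB ov.
rewrite (contraNF (subsetP CA i) iA).
by rewrite (contraNN (subsetP CA j) jA).
Qed.

(** Suppose the true value of an unqueried [j] lies inside [I i]. A non-trivial [j] overlaps [i],
    and [A] is a cover; a trivial [j] is predicted correctly, so [i] lies in [IP]. *)
Lemma queried_feasible : feasible I w A.
Proof.
apply/feasibleP => //; split; last exact: A_covers.
apply/subsetP=> i /value_mandatoryP[j ji h].
have [jA|jA] := boolP (j \in A); first by apply: A_closed h => //; rewrite eq_sym.
have [ntj|tj] := boolP (nontrivial (I j)).
  have := A_covers ji ntj (inside_nontrivial h).
  rewrite (negbTE jA) /=; apply; rewrite overlapC.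
  exact: inside_value_overlap ntj h.
apply/(subsetP BA)/(subsetP IP_B)/value_mandatoryP; exists j => //.
by rewrite (region_trivial (wP j) tj (pP j)) -(region_trivial (wP j) tj (wP j)).
Qed.

(** * Bounds by the prediction errors *)

Let E := A :\: (B :|: C).
Let D := [set c in C | (c \in OPT) && (mate c \in OPT)].

Lemma mem_E i : i \in E -> [/\ i \in A, i \notin B & i \notin C].
Proof. by rewrite !inE negb_or => /andP[/andP[]]. Qed.

(** The matching edges are disjoint, avoid [B] and meet [OPT]; an edge of a vertex in [D]
    contributes both ends. *)
Lemma C_D_le : (#|C| + #|D| <= #|OPT :\: B|)%N.
Proof.
pose phi c := if c \in OPT then c else mate c.
have phi_inj : {in C &, injective phi}.
  move=> c d cC dC; rewrite /phi; case: ifP; case: ifP => // _ _ e.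
  - by have [_ h _ _ _] := mateP dC; rewrite -e cC in h.
  - by have [_ h _ _ _] := mateP cC; rewrite e dC in h.
  - exact: mate_inj.
have DC : {subset D <= C} by move=> c; rewrite inE => /andP[].
have mD : {in D &, injective mate}.
  by move=> c d /DC cC /DC dC; exact: mate_inj.
rewrite -(card_in_imset phi_inj) -(card_in_imset mD) -cardsUI.
have -> : [set phi c | c in C] :&: [set mate c | c in D] = set0.
  apply/setP=> y; rewrite !inE; apply/negP=> /andP[/imsetP[c cC ->] /imsetP[d dD]].
  have dC := DC _ dD; rewrite /phi; case: ifP => co e.
    by have [_ h _ _ _] := mateP dC; rewrite -e cC in h.
  by move: dD; rewrite -(mate_inj cC dC e) inE co andbF.
rewrite cards0 addn0; apply: subset_leq_card; apply/subsetP=> y.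
rewrite inE => /orP[] /imsetP[c].
  move=> cC ->; rewrite !inE /phi; have [h1 h2 h3 h4 h5] := mateP cC.
  case: ifP => co; first by rewrite C_notB.
  rewrite h1; have := OPT_cover h4 h3 (innermost_nontrivial (C_in cC)).
  by rewrite co orbF overlapC; apply.
rewrite inE => /and3P[cC _ h] ->; rewrite inE h andbT.
by have [] := mateP cC.
Qed.

(** [A] splits into [B], [C] and [E]. The part of [B] outside [OPT] comes from [IP] because [M] lies
    in [OPT], and [C_D_le] pays for [C]. *)
Lemma card_A_le : (#|A| + #|D| <= #|OPT| + #|IP :\: OPT| + #|E|)%N.
Proof.
have -> : #|A| = (#|B| + #|C| + #|E|)%N.
  rewrite -(cardsID (B :|: C) A) (setIidPr _) ?subUset ?BA ?CA //.
  have dBC : B :&: C = set0.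
    by apply/setP=> i; rewrite !inE; apply/negP=> /andP[iB /C_notB]; rewrite iB.
  by rewrite cardsU dBC cards0 subn0.
have h1 : (#|B| <= #|B :&: OPT| + #|IP :\: OPT|)%N.
  rewrite -(cardsID OPT B) leq_add2l; apply: subset_leq_card.
  apply/subsetP=> i; rewrite !inE => /andP[io iB]; rewrite io /=.
  move/(subsetP B_sub): (iB); rewrite inE => /orP[|/(subsetP OPT_M)]; first by rewrite inE.
  by rewrite (negbTE io).
have := C_D_le; move: h1; rewrite -(cardsID B OPT) [OPT :&: B]setIC; clear; lia.
Qed.

Lemma late_notIP_M i : i \in E -> i \in M :\: IP.
Proof.
by move=> /mem_E[iA iB iC]; rewrite inE late_M // andbT notB_notIP.
Qed.

(** The two kinds of excess fall into different halves of the symmetric difference: [IP :\: OPT]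
    into [IP :\: M], and late queries into [M :\: IP]. *)
Lemma card_A_le_symdiff :
  (#|A| <= #|OPT| + #|(IP :\: M) :|: (M :\: IP)|)%N.
Proof.
have := card_A_le.
have : (#|IP :\: OPT| + #|E| <= #|(IP :\: M) :|: (M :\: IP)|)%N.
  rewrite -cardsUI (_ : (IP :\: OPT) :&: E = set0) ?cards0 ?addn0.
    apply: subset_leq_card; apply: setUSS.
      by apply: setDS.
    by apply/subsetP=> i /late_notIP_M.
  apply/setP=> i; rewrite [LHS]inE [RHS]inE; apply/negP=> /andP[].
  by rewrite inE => /andP[_ h] /late_notIP_M; rewrite inE h.
by clear; lia.
Qed.

Definition value_witness v i : 'I_n := odflt i [pick j | (j != i) && inside (I i) (v j)].

Lemma value_witnessP v i : i \in value_mandatory I v ->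
  value_witness v i != i /\ inside (I i) (v (value_witness v i)).
Proof.
move=> /value_mandatoryP[j ji h]; rewrite /value_witness.
by case: pickP => [k /andP[]//|/(_ j)]; rewrite ji h.
Qed.

(** As [i] is not mandatory, the true value of [j] is not inside [I i], whereas a trivial [j] would
    be predicted correctly. Moreover [j] overlaps [i], so the cover [OPT] contains [j]. *)
Lemma mispredicted_mandatory_witness i j :
  i \in IP :\: OPT -> j != i -> inside (I i) (p j) ->
  [/\ w j != p j, nontrivial (I j) & j \in OPT].
Proof.
rewrite inE => /andP[io iP] ji h.
have iM : i \notin M by apply: contra io; exact: (subsetP OPT_M).
have wp : w j != p j.
  apply: contra iM => /eqP e; apply/value_mandatoryP; exists j => //.
  by rewrite e.
have ntj : nontrivial (I j).
  apply: contraNT wp => tj; apply/eqP.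
  by rewrite (region_trivial (wP j) tj (pP j)) -(region_trivial (wP j) tj (wP j)).
split=> //; have := OPT_cover ji ntj (inside_nontrivial h).
rewrite (negbTE io) orbF overlapC; apply; exact: inside_value_overlap ntj h.
Qed.

Lemma IP_notOPT_innermost i : i \in IP :\: OPT -> innermost I i.
Proof.
rewrite inE => /andP[io iP]; apply: contraNT io => h; apply: (subsetP OPT_M).
by apply: nested_mandatory h => //; exact: mandatory_nontrivial iP.
Qed.

(** Distinct intervals with a common point inside overlap, and [OPT] would have to contain one of
    them. *)
Lemma IP_notOPT_witness_inj i i' j : i \in IP :\: OPT -> i' \in IP :\: OPT ->
  inside (I i) (p j) -> inside (I i') (p j) -> i = i'.
Proof.
rewrite !inE => /andP[io iP] /andP[i'o i'P] h h'.
apply: not_OPT_eq => //; try exact: inside_nontrivial h; try exact: inside_nontrivial h'.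
exact: common_value_overlap h h'.
Qed.

Lemma card_A_le_wrong : (#|A| <= #|OPT| + #|[set i | w i != p i]|)%N.
Proof.
have := card_A_le.
pose E2 := E :\: [set mate c | c in D].
pose cw i := odflt i [pick j | (j \in C) && inside (I i) (w j)].
have cwP i : i \in E -> cw i \in C /\ inside (I i) (w (cw i)).
  move=> /mem_E[iA iB iC]; have [j jC h] := late_witness iA iB iC; rewrite /cw.
  by case: pickP => [k /andP[]//|/(_ j)]; rewrite jC h.
have hE : (#|E| <= #|D| + #|E2|)%N.
  rewrite -(cardsID [set mate c | c in D] E) leq_add2r.
  apply: leq_trans (subset_leq_card (subsetIr _ _)) _; exact: leq_imset_card.
pose f i := if i \in IP then value_witness p i else cw i.
have E2E i : i \in E2 -> i \in E by rewrite inE => /andP[].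
have fIP i : i \in IP :\: OPT -> [/\ f i != i, inside (I i) (p (f i)), i \in B,
    w (f i) != p (f i) & nontrivial (I (f i)) /\ f i \in OPT].
  move=> h; have /setDP[iP _] := h; rewrite /f iP.
  have [h1 h2] := value_witnessP iP.
  have [? ? ?] := mispredicted_mandatory_witness h h1 h2.
  by split=> //; apply: (subsetP IP_B).
have fE i : i \in E -> [/\ f i != i, f i \in C & inside (I i) (w (f i))].
  move=> h; have /setDP[iM iP] := late_notIP_M h; rewrite /f (negbTE iP).
  have [h1 h2] := cwP i h; split=> //.
  by apply: contraTneq h1 => ->; case/mem_E: h.
(* If a vertex [f i] of [C] were charged in both ways, [i'] could not be its mate, as this would put
   [f i] into [D]. So [f i] has two neighbours outside [B], and its prediction cannot lie in the
   innermost [I i]. *)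
have mixed i i' : i \in IP :\: OPT -> i' \in E2 -> f i <> f i'.
  move=> h h' e; have [f1 f2 iB _ [ntj jo]] := fIP i h.
  have iE := E2E _ h'; have [f3 jC f4] := fE i' iE; rewrite -e in jC f3 f4.
  have [i'A i'B i'C] := mem_E iE.
  have i'o : i' \in OPT by apply: (subsetP OPT_M); exact: late_M.
  have [m1 m2 m3 m4 m5] := mateP jC.
  have i'm : i' != mate (f i).
    apply: contraTneq h' => i'm; rewrite inE negb_and negbK; apply/orP; left.
    by apply/imsetP; exists (f i) => //; rewrite inE jC jo -i'm.
  have i'j : i' != f i by rewrite eq_sym.
  have ij : i != f i by rewrite eq_sym.
  have ov1 : overlap I i' (f i) by exact: inside_value_overlap ntj f4.
  rewrite overlapC in m5.
  have := two_neighbours_predicted_outside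
    (And3 ntj (inside_nontrivial f4) m3) (And3 (C_notB jC) i'B m1)
    i'm i'j m4 ov1 m5 (IP_notOPT_innermost h) ij.
  by rewrite f2.
have finj : {in (IP :\: OPT) :|: E2 &, injective f}.
  move=> i i' /setUP[] h /setUP[] h' e.
  - have [_ a1 _ _ _] := fIP i h; have [_ a2 _ _ _] := fIP i' h'.
    by rewrite -e in a2; exact: IP_notOPT_witness_inj a1 a2.
  - by case: (mixed i i' h h').
  - by case: (mixed i' i h' h).
  - apply/eqP/negPn/negP=> ii.
    have h1 := E2E _ h; have h2 := E2E _ h'.
    have [_ _ a1] := fE i h1; have [_ _ a2] := fE i' h2; rewrite -e in a2.
    have [iA iB iC] := mem_E h1; have [jA jB jC] := mem_E h2.
    have := notB_overlap_C ii (inside_nontrivial a1) (inside_nontrivial a2) iB jB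
      (common_value_overlap a1 a2).
    by rewrite (negbTE iC) (negbTE jC).
have : (#|IP :\: OPT| + #|E2| <= #|[set i | w i != p i]|)%N.
  rewrite -cardsUI (_ : (IP :\: OPT) :&: E2 = set0) ?cards0 ?addn0; last first.
    apply/setP=> i; rewrite [LHS]inE [RHS]inE; apply/negP=> /andP[].
    by rewrite inE => /andP[_ h] /E2E/late_notIP_M; rewrite inE h.
  rewrite -(card_in_imset finj); apply: subset_leq_card; apply/subsetP=> y.
  move=> /imsetP[i /setUP[] h ->]; rewrite inE.
    by have [] := fIP i h.
  have [_ h1 h2] := fE i (E2E _ h).
  have /setDP[_ iP] := late_notIP_M (E2E _ h).
  apply: contra iP => /eqP e; apply/value_mandatoryP; exists (f i); last by rewrite -e.
  by have [] := fE i (E2E _ h).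
by move: hE; clear; lia.
Qed.


(* A critical component contains a vertex of [T], and the vertices of [T] are
   charged to distinct mandatory intervals of [outer]. *)
Let outer : {set 'I_n} := [set i | nontrivial (I i) && ~~ innermost I i].
Let T : {set 'I_n} := [set y in IP :\: OPT |
  [exists j, [&& j \in outer, j != y & inside (I y) (p j)]]].

Lemma card_T_le : (#|T| <= #|outer|)%N.
Proof.
pose f y := odflt y [pick j | [&& j \in outer, j != y & inside (I y) (p j)]].
have fP y : y \in T -> [/\ y \in IP :\: OPT, f y \in outer & inside (I y) (p (f y))].
  rewrite inE => /andP[h /existsP[j hj]]; rewrite /f.
  by case: pickP => [k /and3P[]//|/(_ j)]; rewrite hj.
have finj : {in T &, injective f}.
  move=> y z /fP[y1 _ y2] /fP[z1 _ z2] e; rewrite -e in z2.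
  exact: IP_notOPT_witness_inj y2 z2.
rewrite -(card_in_imset finj); apply: subset_leq_card; apply/subsetP=> z.
by move=> /imsetP[y /fP[_ h _] ->].
Qed.

Lemma late_witness_pos k : (k < m)%N -> x k \in A -> x k \notin B ->
  x k \notin C -> exists2 l, k = l.+1 \/ l = k.+1 &
  [/\ (l < m)%N, x l \in C & inside (I (x k)) (w (x l))].
Proof.
move=> km kA kB kC; have [j jC h] := late_witness kA kB kC.
have jn := innermost_nontrivial (C_in jC).
have kj : x k != j by apply: contraNneq kC => ->.
have ov := inside_value_overlap wP jn h.
have [l [al e]] := overlap_outside_IP_adj kj (x_nontrivial km) jn
  (notB_notIP kB) (notB_notIP (C_notB jC)) ov.
have [_ l1m lm] := adj_lt al; rewrite /= in lm.
case: e => -[e1 e2].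
  by exists l.+1; [right; rewrite (x_inj km lm e1)|rewrite -e2].
by exists l; [left; rewrite (x_inj km l1m e2)|rewrite -e1].
Qed.

(** The two would overlap outside [B] with neither in the cover [C]. *)
Lemma late_no_common_value k l y : (k < l < m)%N -> x k \notin B -> x l \notin B ->
  x k \notin C -> x l \notin C ->
  inside (I (x k)) y -> inside (I (x l)) y -> False.
Proof.
move=> klm kB lB kC lC h1 h2; have h := x_lt klm.
have kl : x k != x l by apply: contraTneq h => ->; rewrite ltxx.
have := notB_overlap_C kl (inside_nontrivial h1) (inside_nontrivial h2) kB lB
  (common_value_overlap h1 h2).
by rewrite (negbTE kC) (negbTE lC).
Qed.

(** Unmarked vertices are taken only on paths with both ends marked, hence they are interior. *)
Lemma unmarked_C_links k : (k < m)%N -> ~~ mark k -> x k \in C ->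
  link k /\ link k.+1.
Proof.
move=> km mk; rewrite CE // => /andP[kB]; have := spE km; have := epE km.
move: mk; case: (mark k) => // _.
by case: (link k); case: (sp _) => //; case: (link k.+1); case: (ep _).
Qed.

Lemma adj_cover k : adj k -> (x k.-1 \in OPT) || (x k \in OPT).
Proof.
move=> ak; have [k0 km k1m] := adj_lt ak.
apply: OPT_cover; rewrite ?adj_overlap ?x_nontrivial //.
by apply/eqP=> /x_inj -/(_ k1m km); move: k0; clear; lia.
Qed.

(** * The factor two on one component of innermost intervals *)

Section Run.
Variables a b : nat.
Hypothesis ab : (a < b)%N.
Hypothesis bm : (b <= m)%N.
Hypothesis a_start : ~~ adj a.
Hypothesis b_end : ~~ adj b.
Hypothesis run_adj : forall k, (a < k < b)%N -> adj k.

Lemma run_lt k : (k < b)%N -> (k < m)%N.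
Proof. by move=> /leq_trans; apply. Qed.

Lemma run_mark t : (a + t < b)%N -> mark (a + t) = odd t.
Proof.
elim: t => [|t IH] tb; rewrite markE ?run_lt //.
  by rewrite addn0 (negbTE a_start).
rewrite addnS in tb *; rewrite /= IH 1?ltnW // run_adj //.
by rewrite tb ltnS leq_addr.
Qed.

Lemma run_markS k : (a <= k)%N -> (k.+1 < b)%N -> mark k.+1 = ~~ mark k.
Proof.
by move=> ak kb; rewrite markE ?run_lt // run_adj // ltnS ak kb.
Qed.

(** * Refutation of critical components without a vertex of [T] *)

Section Tight.
Hypothesis last_unmarked : ~~ mark b.-1.
Hypothesis OPT_mark : forall k, (a <= k < b)%N -> (x k \in OPT) = mark k.
Hypothesis all_A : forall k, (a <= k < b)%N -> x k \in A.
Hypothesis no_T : forall k, (a <= k < b)%N -> x k \notin T.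

Lemma tight_C_neighbours k : (a <= k < b)%N -> ~~ mark k -> x k \in C ->
  [/\ (a < k)%N, (k.+2 < b)%N, link k & link k.+1] /\
  [/\ x k.-1 \notin B, x k.-1 \notin C, x k.+1 \notin B & x k.+1 \notin C].
Proof.
move=> /andP[ak kb] mk kC; have [l1 l2] := unmarked_C_links (run_lt kb) mk kC.
have c1 := link_C l1; have c2 := link_C l2.
have /and3P[a1 b1 _] := l1; have /and3P[a2 _ b2] := l2.
split; split=> //; rewrite -?c1 ?c2 //= ?kC //.
  by rewrite ltn_neqAle ak andbT; apply: contraNneq a_start => ->.
have k1b : (k.+1 < b)%N.
  by rewrite ltn_neqAle kb andbT; apply: contraNneq b_end => <-.
rewrite ltn_neqAle k1b andbT; apply: contraNneq last_unmarked => <- /=.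
by rewrite run_markS.
Qed.

(** The left neighbour is late, so one of its own neighbours in [C] triggered it. If that were
    [k - 2], the induction would place its value inside [x (k - 3)] as well, and two late intervals
    would share a value. *)
Lemma tight_C_value_left k : (a <= k < b)%N -> ~~ mark k -> x k \in C ->
  inside (I (x k.-1)) (w (x k)).
Proof.
elim/ltn_ind: k => k IH kab mk kC.
have [[ak kb l1 l2] [b1 c1 b2 c2]] := tight_C_neighbours kab mk kC.
have [k0 km k1m] := link_lt l1.
have k1A : x k.-1 \in A.
  by apply: all_A; move: ak kb; clear; lia.
have [l lk [lm lC h]] := late_witness_pos k1m k1A b1 c1.
have [e|e] : l = k \/ k = l.+2 by move: lk k0; clear; lia.
  by rewrite e in h.
have al : (a <= l)%N.
  rewrite leqNgt; apply/negP=> la; have e2 : k.-1 = a by move: ak la e; clear; lia.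
  have : mark k = ~~ mark k.-1 by exact: link_mark.
  have := @run_mark 0; rewrite addn0 ab => /(_ isT) /= ma.
  by rewrite e2 ma (negbTE mk).
have ml : ~~ mark l.
  have l2b : (l.+2 < b)%N by rewrite -e; exact: ltnW (ltnW kb).
  have h1 := run_markS al (ltnW l2b).
  have h2 := run_markS (leqW al) l2b.
  by move: mk; rewrite e h2 h1 negbK.
have lb : (a <= l < b)%N by rewrite al; move: kb e; clear; lia.
have lk' : (l < k)%N by rewrite e.
have hl := IH l lk' lb ml lC.
have [[al' _ _ _] [b3 c3 b4 c4]] := tight_C_neighbours lb ml lC.
case: (@late_no_common_value l.-1 k.-1 (w (x l))) => //.
by rewrite k1m andbT e /=; move: al'; clear; lia.
Qed.

(** The right neighbour is late, too. Its trigger is not [x k], whose value already lies inside the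
    left neighbour, so it is [x (k + 2)]. *)
Lemma tight_C_next k : (a <= k < b)%N -> ~~ mark k -> x k \in C ->
  [/\ (a <= k.+2 < b)%N, ~~ mark k.+2 & x k.+2 \in C].
Proof.
move=> kab mk kC.
have [[ak kb l1 l2] [b1 c1 b2 c2]] := tight_C_neighbours kab mk kC.
have hl := tight_C_value_left kab mk kC.
have k2a : (a <= k.+2 < b)%N by rewrite kb andbT; move: ak; clear; lia.
have m2 : ~~ mark k.+2.
  by rewrite (run_markS (leqW (ltnW ak)) kb) (run_markS (ltnW ak) (ltnW kb)) negbK.
split=> //; have k1A : x k.+1 \in A by apply: all_A; move: ak kb; clear; lia.
have k1m : (k.+1 < m)%N := run_lt (ltnW kb).
have [l lk [lm lC h]] := late_witness_pos k1m k1A b2 c2.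
have [e|e] : l = k \/ l = k.+2 by move: lk; clear; lia.
  rewrite e in h; case: (@late_no_common_value k.-1 k.+1 (w (x k))) => //.
  by rewrite k1m andbT; move: ak; clear; lia.
by rewrite -e.
Qed.

(** Otherwise [tight_C_next] would lead through [k + 2], [k + 4] and so on beyond the end of the
    component. *)
Lemma tight_unmarked_not_C k : (a <= k < b)%N -> ~~ mark k -> x k \notin C.
Proof.
have [N] := ubnP (b - k); elim: N k => // N IH k kN kab mk; apply/negP=> kC.
have [h1 h2 h3] := tight_C_next kab mk kC.
move: h3; apply/negP; apply: IH => //; move: kN h1; clear; lia.
Qed.

(** An unmarked interval is outside [OPT], hence not mandatory, while a late query would be. So it
    is in [B], and only through a prediction. *)
Lemma tight_unmarked_IP k : (a <= k < b)%N -> ~~ mark k -> x k \in IP :\: OPT.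
Proof.
move=> kab mk; have ko : x k \notin OPT by rewrite OPT_mark.
have kM : x k \notin M by apply: contra ko; exact: (subsetP OPT_M).
rewrite inE ko /=; have kC := tight_unmarked_not_C kab mk.
have : x k \in B.
  by apply: contraNT kM => kB; apply: late_M => //; exact: all_A.
by move/(subsetP B_sub); rewrite inE (negbTE kM) orbF.
Qed.

Lemma overlap_run k l : (k < l < m)%N -> lo (x l) < hi (x k) ->
  forall j, (k < j <= l)%N -> adj j.
Proof.
move=> /andP[kl lm] ov [|j] /andP[kj jl] //; rewrite /adj /= (leq_ltn_trans jl lm) /=.
have h1 : lo (x j.+1) <= lo (x l).
  by move: jl; rewrite leq_eqVlt => /orP[/eqP->//|jl]; apply/ltW/x_lt; rewrite jl.
have h2 : hi (x k) <= hi (x j).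
  move: kj; rewrite ltnS leq_eqVlt => /orP[/eqP->//|kj].
  by apply/ltW/x_hi; rewrite kj (leq_trans jl (ltnW lm)).
exact: le_lt_trans h1 (lt_le_trans ov h2).
Qed.

Lemma tight_no_common_unmarked k l : (a <= k < b)%N -> (a <= l < b)%N ->
  ~~ mark k -> ~~ mark l -> overlap I (x k) (x l) -> k = l.
Proof.
move=> kab lab mk ml ov.
have km : (k < m)%N by case/andP: kab => _ /run_lt.
have lm : (l < m)%N by case/andP: lab => _ /run_lt.
apply: x_inj => //; apply: not_OPT_eq; rewrite ?x_nontrivial ?OPT_mark //.
Qed.

(** By [no_T] the prediction that triggers [x k] belongs to an innermost interval. It is a
    neighbour, since otherwise [x k] would overlap an unmarked interval at distance two. It is not
    the left one, whose prediction lies inside [x (k - 2)] by induction. *)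
Lemma tight_prediction_right k : (a <= k < b)%N -> ~~ mark k ->
  (k.+1 < b)%N /\ inside (I (x k)) (p (x k.+1)).
Proof.
elim/ltn_ind: k => k IH kab mk; have /andP[ak kb] := kab.
have km := run_lt kb.
have kIP := tight_unmarked_IP kab mk.
have /value_witnessP[] : x k \in IP by move: kIP; rewrite inE => /andP[].
set j := value_witness _ _ => jk h.
have [_ ntj jo] := mispredicted_mandatory_witness kIP jk h.
have jin : innermost I j.
  have := no_T kab; apply: contraNT => nj; rewrite inE kIP; apply/existsP; exists j.
  by rewrite inE ntj nj jk h.
have [l lm el] := x_onto jin; rewrite -el in h jk.
have /andP[o1 o2] := inside_value_overlap pP (x_nontrivial lm) h.
case: (ltngtP l k) => [lk|kl|e]; last by rewrite e eqxx in jk.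
- have run := @overlap_run l k; rewrite lk km in run.
  have {}run := run isT o1.
  have al : (a <= l)%N.
    rewrite leqNgt; apply: contra a_start => la; apply: run; by rewrite la.
  have ek : k = l.+1.
    apply/eqP; rewrite eqn_leq lk andbT leqNgt; apply/negP=> lk2.
    have k2 : (a <= k.-2 < b)%N by move: al lk2 kb; clear; lia.
    have mk2 : ~~ mark k.-2.
      have k1b : (k.-2.+1 < b)%N by move: lk2 kb; clear; lia.
      have k2b : (k.-2.+2 < b)%N by move: lk2 kb; clear; lia.
      have /andP[k2a _] := k2.
      have h1 := run_markS k2a k1b.
      have h2 := run_markS (leqW k2a) k2b.
      by move: mk; rewrite -[k in mark k](_ : k.-2.+2 = k) ?h2 ?h1 ?negbK //;
         move: lk2; clear; lia.
    suff : k.-2 = k by move: lk2; clear; lia.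
    apply: tight_no_common_unmarked => //.
    rewrite /overlap; apply/andP; split.
      have [g1 g2] := value_inside pP (x_nontrivial km).
      by apply: lt_trans (lt_trans g1 g2); apply: x_lt; move: lk2 km; clear; lia.
    have : hi (x l) <= hi (x k.-2).
      have : (l <= k.-2)%N by move: lk2; clear; lia.
      rewrite leq_eqVlt => /orP[/eqP->//|g]; apply/ltW/x_hi; rewrite g.
      by move: km; clear; lia.
    exact: lt_le_trans o1.
  have al1 : (a < l)%N.
    rewrite ltn_neqAle al andbT; apply: contraTneq mk => e.
    have := @run_mark 1; rewrite addn1 e -ek => /(_ kb) -> //.
  have el1 : (l.-1.+1 = l)%N by rewrite prednK //; exact: leq_ltn_trans al1.
  have lb : (l < b)%N := ltn_trans lk kb.
  have ml : ~~ mark l.-1.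
    have h1 := @run_markS l.-1; rewrite el1 -ltnS el1 al1 lb in h1.
    have h2 := run_markS al; rewrite -ek kb in h2.
    by move: mk; rewrite h2 // h1 // negbK.
  have lab : (a <= l.-1 < b)%N by move: al1 lb; clear; lia.
  have l1k : (l.-1 < k)%N by rewrite ek ltnS leq_pred.
  have [_ hl] := IH _ l1k lab ml; rewrite el1 in hl.
  have e := IP_notOPT_witness_inj kIP (tight_unmarked_IP lab ml) h hl.
  have l1m : (l.-1 < m)%N by apply: run_lt; case/andP: lab.
  by have := x_inj km l1m e; move: l1k; clear; lia.
- have run := @overlap_run k l; rewrite kl lm in run.
  have {}run := run isT o2.
  have lb : (l < b)%N.
    rewrite ltnNge; apply: contra b_end => bl; apply: run; by rewrite kb bl.
  have k1b : (k.+1 < b)%N := leq_ltn_trans kl lb.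
  have <- : l = k.+1; last by [].
  apply/eqP; rewrite eqn_leq kl andbT leqNgt; apply/negP=> kl2.
  have k2b : (k.+2 < b)%N := leq_ltn_trans kl2 lb.
  have k2 : (a <= k.+2 < b)%N by rewrite k2b andbT; exact: leqW (leqW ak).
  have mk2 : ~~ mark k.+2.
    by rewrite (run_markS (leqW ak) k2b) (run_markS ak k1b) negbK.
  suff : k = k.+2 by clear; lia.
  apply: tight_no_common_unmarked => //.
  rewrite /overlap; apply/andP; split.
    have [g1 g2] := value_inside pP (x_nontrivial (run_lt k2b)).
    apply: lt_trans (lt_trans g1 g2); apply: x_lt.
    by rewrite (run_lt k2b) andbT.
  have : lo (x k.+2) <= lo (x l).
    by move: kl2; rewrite leq_eqVlt => /orP[/eqP->//|g]; apply/ltW/x_lt; rewrite g.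
  by move=> /le_lt_trans; apply.
Qed.

(** The last position is unmarked and has no right neighbour. *)
Lemma tight_absurd : False.
Proof.
have e : b.-1.+1 = b by rewrite prednK //; exact: leq_ltn_trans ab.
have b1 : (a <= b.-1 < b)%N by move: e ab; clear; lia.
by have [] := tight_prediction_right b1 last_unmarked; rewrite e ltnn.
Qed.

End Tight.

(** A matching suffices unless the length is [2q + 1], [OPT] meets the component in exactly [q]
    vertices and all of it is queried. Then [OPT] is the set of marked vertices, and by
    [tight_absurd] some vertex of [T] supplies the missing unit. *)
Lemma run_bound :
  (\sum_(a <= k < b) (x k \in A) <=
   2 * \sum_(a <= k < b) (x k \in OPT) + \sum_(a <= k < b) (x k \in T))%N.
Proof.
have sA : (\sum_(a <= k < b) (x k \in A) <= b - a)%N.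
  by rewrite -(muln1 (b - a)%N) -sum_nat_const_nat; apply: leq_sum => k _; exact: leq_b1.
pose g t := x (t + a)%N \in OPT.
have sO : (\sum_(a <= k < b) (x k \in OPT) = \sum_(0 <= t < b - a) g t)%N.
  by rewrite -{1}[a]add0n big_addn.
have gcov t : (t.+1 < b - a)%N -> g t || g t.+1.
  move=> tb; apply: (adj_cover (k := (t.+1 + a)%N)); apply: run_adj.
  by move: tb; clear; lia.
have [q [e|e]] : exists q, (b - a = q.*2 \/ b - a = q.*2.+1)%N.
  exists (b - a)./2%N; have := odd_double_half (b - a)%N.
  by case: (odd _) => <-; [right|left]; rewrite ?add1n ?add0n /= ?uphalf_double ?half_double.
  have := @matched_count g q; rewrite -e -sO => /(_ gcov).
  by move: sA; rewrite e; clear; lia.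
have [big|small] := ltnP q (\sum_(a <= k < b) (x k \in OPT)).
  by move: sA; rewrite e; move: big; clear; lia.
have gq t : (t < q.*2)%N -> g t || g t.+1 by move=> tq; apply: gcov; rewrite e.
have low : (q <= \sum_(a <= k < b) (x k \in OPT))%N.
  have := matched_count (fun t tq => gq t (ltnW tq)).
  by rewrite sO e big_nat_recr //=; clear; lia.
have godd := @tight_odd_path_cover g q gq; rewrite -e -sO in godd.
have {}godd := godd small.
have shift k : (a <= k < b)%N -> (k - a <= q.*2)%N /\ (k - a + a = k)%N.
  by move=> kab; rewrite -ltnS -e; move: kab; clear; lia.
have OPT_mark k : (a <= k < b)%N -> (x k \in OPT) = mark k.
  move=> kab; have [h1 h2] := shift k kab.
  have := godd _ h1; rewrite /g h2 => ->.
  by rewrite -[in RHS]h2 addnC run_mark // addnC h2; case/andP: kab.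
have last : ~~ mark b.-1.
  have e1 : (a + q.*2 = b.-1)%N by move: e ab; clear; lia.
  by rewrite -e1 run_mark ?odd_double // e1; move: ab; clear; lia.
have lower_count (P : nat -> bool) : (exists2 k, (a <= k < b)%N & ~~ P k) ->
    (\sum_(a <= k < b) P k < b - a)%N.
  case=> k /andP[ak kb] Pk; rewrite (big_cat_nat ak (ltnW kb)) /=.
  have cnt c d : (\sum_(c <= l < d) P l <= d - c)%N.
    by rewrite -(muln1 (d - c)%N) -sum_nat_const_nat; apply: leq_sum => l _; exact: leq_b1.
  rewrite (big_ltn kb) (negbTE Pk) add0n.
  have := cnt a k; have := cnt k.+1 b; move: ak kb; clear; lia.
have [nA|allA] := pselect (exists2 k, (a <= k < b)%N & x k \notin A).
  have := lower_count (fun k => x k \in A) nA.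
  by rewrite e; move: low; clear; lia.
have [yT|noT] := pselect (exists2 k, (a <= k < b)%N & x k \in T).
  have [k kab kT] := yT.
  have h : (\sum_(a <= k < b) (x k \notin T) < b - a)%N.
    by apply: (lower_count (fun k => x k \notin T)); exists k; rewrite ?negbK.
  have : (\sum_(a <= k < b) (x k \in T) + \sum_(a <= k < b) (x k \notin T) = b - a)%N.
    rewrite -big_split /= -(muln1 (b - a)%N) -sum_nat_const_nat.
    by apply: eq_bigr => l _; case: (_ \in _).
  by move: h sA low; rewrite e; clear; lia.
exfalso; apply: (tight_absurd last OPT_mark).
- by move=> k kab; apply/negPn/negP=> h; apply: allA; exists k.
- by move=> k kab; apply/negP=> h; apply: noT; exists k.
Qed.

End Run.

(** Induction cuts off the last component, which starts at the largest [a < b] with [~~ adj a]. *)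
Lemma prefix_bound b : (b <= m)%N -> ~~ adj b ->
  (\sum_(0 <= k < b) (x k \in A) <=
   2 * \sum_(0 <= k < b) (x k \in OPT) + \sum_(0 <= k < b) (x k \in T))%N.
Proof.
elim/ltn_ind: b => b IH bm nb.
have [->|b0] := posnP b; first by rewrite !big_geq.
have ex : exists a, (a < b)%N && ~~ adj a by exists 0%N; rewrite b0.
have ub a : (a < b)%N && ~~ adj a -> (a <= b)%N by case/andP=> /ltnW.
case: (ex_maxnP ex ub) => a /andP[ab na] amax.
have run k : (a < k < b)%N -> adj k.
  move=> /andP[ak kb]; apply/negPn/negP=> nk.
  by have := amax k; rewrite kb nk leqNgt ak => /(_ isT).
have h1 := IH a ab (leq_trans (ltnW ab) bm) na.
have h2 := run_bound ab bm na nb run.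
have cat (F : nat -> nat) : (\sum_(0 <= k < b) F k =
    \sum_(0 <= k < a) F k + \sum_(a <= k < b) F k)%N.
  by rewrite (big_cat_nat (leq0n a) (ltnW ab)).
by rewrite !cat; move: h1 h2; clear; lia.
Qed.

Lemma sum_positions (S : {set 'I_n}) :
  (\sum_(0 <= k < m) (x k \in S) = #|S :&: [set i | innermost I i]|)%N.
Proof.
rewrite big_mkord.
have -> : S :&: [set i | innermost I i] = [set x k | k : 'I_m in [set k : 'I_m | x k \in S]].
  apply/setP=> i; rewrite !inE; apply/andP/imsetP.
    by move=> [iS /x_onto[k km e]]; exists (Ordinal km); rewrite ?inE /= e.
  by move=> [k]; rewrite inE => kS ->; split=> //; exact: x_in.
rewrite card_in_imset; last first.
  by move=> k l _ _ e; apply: val_inj; exact: x_inj (ltn_ord k) (ltn_ord l) e.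
by rewrite -sum1_card [RHS]big_mkcond /=; apply: eq_bigr => k _; rewrite inE; case: ifP.
Qed.

(** Queried intervals that are not innermost lie in [outer], and [outer] lies in [OPT]. The factor
    two counts [outer] twice: one copy pays for these queries, the other for [T]. *)
Lemma card_A_le_double : (#|A| <= 2 * #|OPT|)%N.
Proof.
have nm : ~~ adj m by rewrite /adj ltnn andbF.
have := prefix_bound (leqnn m) nm; rewrite !sum_positions.
set G : {set 'I_n} := [set i | innermost I i].
have h1 : (#|A :\: G| <= #|outer|)%N.
  apply: subset_leq_card; apply/subsetP=> i; rewrite !inE => /andP[-> iA].
  by rewrite andbT; exact: A_sub_nontrivial.
have h2 : (#|outer| <= #|OPT :\: G|)%N.
  apply: subset_leq_card; apply/subsetP=> i; rewrite !inE => /andP[nt ni].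
  by rewrite ni /=; apply: (subsetP OPT_M); exact: nested_mandatory.
have h3 : (#|T :&: G| <= #|T|)%N by apply: subset_leq_card; exact: subsetIl.
rewrite -(cardsID G A) -(cardsID G OPT).
have := card_T_le; move: h1 h2 h3; clear.
move: #|A :&: G| #|OPT :&: G| #|T :&: G| #|A :\: G| #|OPT :\: G| #|T| #|outer|.
lia.
Qed.

End Analysis.

(** * Program logic *)

(* Bounds the running time of [P] provided that each loop makes at most [n]
   iterations each time it is entered. *)
Fixpoint time (n : nat) (P : program) : nat :=
  match P with
  | Seq P1 P2 => time n P1 + time n P2
  | If _ P1 P2 => (time n P1 + time n P2).+1
  | While _ P1 => (n * (time n P1).+1).+1
  | _ => 1
  end%N.

Lemma time_polynomial P :
  exists c d, forall n, (time n P <= c * n ^ d + c)%N.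
Proof.
(* The summand 1 covers [n = 0], where [0 ^ 0 = 1]. *)
have expD n d e : (n ^ d <= n ^ (d + e) + 1)%N.
  have [->|n0] := posnP n; first by case: d => [|d]; [rewrite expn0 leq_addl|rewrite exp0n].
  by rewrite (leq_trans _ (leq_addr _ _)) // leq_pexp2l // leq_addr.
have two P1 P2 : (exists c d, forall n, (time n P1 <= c * n ^ d + c)%N) ->
    (exists c d, forall n, (time n P2 <= c * n ^ d + c)%N) ->
    exists c d, forall n, ((time n P1 + time n P2).+1 <= c * n ^ d + c)%N.
  move=> [c1 [d1 h1]] [c2 [d2 h2]].
  exists (2 * (c1 + c2)).+1%N, (d1 + d2)%N => n.
  have e1 := expD n d1 d2; have e2 := expD n d2 d1; rewrite [(d2 + d1)%N]addnC in e2.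
  have := h1 n; have := h2 n; move: e1 e2; clear.
  move: (n ^ (d1 + d2))%N (n ^ d1)%N (n ^ d2)%N (time n P1) (time n P2); nia.
elim: P => [|a e1 e2|r1 e1 r2 e2|e r e'|P1 IH1 P2 IH2|b P1 IH1 P2 IH2|b P [c [d h]]] /=;
  try by exists 1%N, 0%N.
- have [c [d h]] := two _ _ IH1 IH2; exists c, d => n; exact: ltnW (h n).
- exact: two.
exists (2 * c).+2%N, d.+1 => n.
have := h n; have := expD n 1%N d; rewrite add1n expn1 expnS; clear.
move: (n ^ d)%N (time n P) => y t h1 h2.
have : (n * t.+1 <= n * (c * y + c).+1)%N by rewrite leq_mul2l ltnS h2 orbT.
have [->|n0] := posnP n; first by rewrite mul0n; lia.
nia.
Qed.

Section Runs.
Variables (R : realFieldType) (n : nat) (w : 'I_n -> R).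
Implicit Types (P : program) (s : state R n) (Post : state R n -> Prop).

(** Total correctness with the bound [time] built in. The postcondition serves as a continuation, so
    a program is run symbolically, one command at a time. *)
Definition runs P s Post : Prop :=
  exists t s', [/\ exec w P s t s', (t <= time n P)%N & Post s'].

Lemma runs_weaken P s (Post Post' : state R n -> Prop) :
  (forall s', Post s' -> Post' s') -> runs P s Post -> runs P s Post'.
Proof. by move=> h [t [s' [e l p]]]; exists t, s'; split=> //; exact: h. Qed.

Lemma runs_skip s Post : Post s -> runs Skip s Post.
Proof. by move=> h; exists 1%N, s; split=> //; constructor. Qed.

Lemma runs_setnat a e1 e2 s Post :
  Post (State (update (nats s) a (neval (nats s) e1) (neval (nats s) e2))
              (reals s) (queries s)) ->
  runs (SetNat a e1 e2) s Post.
Proof. by move=> h; eexists; eexists; split; last exact: h; [constructor|]. Qed.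

Lemma runs_setreal r1 e1 r2 e2 s Post :
  Post (State (nats s) (update (reals s) r1 (neval (nats s) e1)
                               (reals s r2 (neval (nats s) e2))) (queries s)) ->
  runs (SetReal r1 e1 r2 e2) s Post.
Proof. by move=> h; eexists; eexists; split; last exact: h; [constructor|]. Qed.

Lemma runs_query e r e' s (i : 'I_n) Post :
  neval (nats s) e = i ->
  Post (State (nats s) (update (reals s) r (neval (nats s) e') (w i))
              (i :: queries s)) ->
  runs (Query e r e') s Post.
Proof. by move=> ei h; eexists; eexists; split; last exact: h; [constructor|]. Qed.

Lemma runs_seq P1 P2 s Post :
  runs P1 s (fun s1 => runs P2 s1 Post) -> runs (Seq P1 P2) s Post.
Proof.
move=> [t1 [s1 [e1 l1 [t2 [s2 [e2 l2 h]]]]]]; exists (t1 + t2)%N, s2; split=> //.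
  exact: exec_seq e1 e2.
exact: leq_add.
Qed.

Lemma runs_if b P1 P2 s Post :
  (teval s b -> runs P1 s Post) -> (~~ teval s b -> runs P2 s Post) ->
  runs (If b P1 P2) s Post.
Proof.
case hb: (teval s b) => /= h1 h2.
  have [t [s' [e l h]]] := h1 isT; exists t.+1, s'; split=> //=.
    by apply: exec_if; rewrite hb.
  by rewrite ltnS (leq_trans l) // leq_addr.
have [t [s' [e l h]]] := h2 isT; exists t.+1, s'; split=> //=.
  by apply: exec_if; rewrite hb.
by rewrite ltnS (leq_trans l) // leq_addl.
Qed.

End Runs.

(* The number of intervals is kept in cell 0 of array 0. *)
Definition For (c : nat) (P : program) : program :=
  Seq (SetNat c (Const 0) (Const 0))
      (While (Not (NatLe (Get 0 (Const 0)) (Get c (Const 0))))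
             (Seq P (SetNat c (Const 0) (Add (Get c (Const 0)) (Const 1))))).

Definition Count (c f : nat) (b : test) : program :=
  Seq (SetNat f (Const 0) (Const 0))
      (For c (If b (SetNat f (Const 0) (Add (Get f (Const 0)) (Const 1))) Skip)).

Section Loops.
Variables (R : realFieldType) (n : nat) (w : 'I_n -> R).
Implicit Types (P : program) (s : state R n) (Post : state R n -> Prop).

Lemma runs_for (Inv : nat -> state R n -> Prop) c P s :
  c != 0%N ->
  (forall k s', Inv k s' -> nats s' 0 0 = n) ->
  (forall k v s', Inv k s' ->
     Inv k (State (update (nats s') c 0 v) (reals s') (queries s'))) ->
  (forall k s', (k < n)%N -> Inv k s' -> nats s' c 0 = k ->
     runs w P s' (fun s'' => Inv k.+1 s'' /\ nats s'' c 0 = k)) ->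
  Inv 0 s -> runs w (For c P) s (Inv n).
Proof.
move=> c0 Invn Invc body Inv0.
(* Induction on the number [d] of remaining iterations, each costing the body, one test and one
   increment. *)
have loop d : forall k s', (k + d = n)%N -> Inv k s' -> nats s' c 0 = k ->
    exists t s'', [/\ exec w (While (Not (NatLe (Get 0 (Const 0)) (Get c (Const 0))))
             (Seq P (SetNat c (Const 0) (Add (Get c (Const 0)) (Const 1))))) s' t s'',
      (t <= (d * (time n P).+2).+1)%N & Inv n s''].
  elim: d => [|d IH] k s' kd Ik ck.
    exists 1%N, s'; split=> //; last by rewrite -kd addn0.
    by apply: exec_while_false; rewrite /= negbK (Invn _ _ Ik) ck -kd addn0.
  have kn : (k < n)%N by rewrite -kd -addSnnS ltn_addr.
  have [t1 [s1 [e1 l1 [I1 c1]]]] := body k s' kn Ik ck.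
  have I2 := Invc _ (nats s1 c 0 + 1)%N _ I1.
  have kd' : (k.+1 + d = n)%N by rewrite addSnnS.
  have [|t2 [s2 [e2 l2 h2]]] := IH _ _ kd' I2.
    by rewrite /= /update !eqxx c1 addn1.
  exists ((t1 + 1) + t2).+1, s2; split=> //; last first.
    by move: l1 l2; clear; lia.
  apply: exec_while_true e2; last by apply: exec_seq e1 _; constructor.
  by rewrite /= (Invn _ _ Ik) ck -ltnNge.
have I0 := Invc _ 0%N _ Inv0.
have [|t [s' [e l h]]] := loop n 0%N _ (add0n n) I0.
  by rewrite /= /update !eqxx.
exists (1 + t)%N, s'; split=> //; last first.
  by move: l => /=; clear; lia.
apply: exec_seq e; exact: exec_setnat.
Qed.

Lemma sum_ord_ltnS (t : 'I_n -> bool) (k : 'I_n) :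
  (\sum_(j < n) ((j < k.+1) && t j) = \sum_(j < n) ((j < k) && t j) + t k)%N.
Proof.
rewrite (bigD1 k) //= [in RHS](bigD1 k) //= ltnn add0n ltnSn addnC; congr (_ + _)%N.
by apply: eq_bigr => j jk; rewrite ltnS leq_eqVlt -val_eqE in jk *; rewrite (negbTE jk).
Qed.

Lemma runs_count (t : 'I_n -> bool) c f b s Post :
  c != 0%N -> f != 0%N -> c != f -> nats s 0 0 = n ->
  (forall s' (k : 'I_n),
     (forall a, a != c -> a != f -> nats s' a =1 nats s a) ->
     reals s' = reals s -> nats s' c 0 = k -> teval s' b = t k) ->
  (forall s', (forall a, a != c -> a != f -> nats s' a =1 nats s a) ->
     reals s' = reals s -> queries s' = queries s ->
     nats s' f 0 = #|[set j | t j]| -> Post s') ->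
  runs w (Count c f b) s Post.
Proof.
move=> c0 f0 cf sn bt post; apply: runs_seq; apply: runs_setnat.
pose Inv k s' := [/\ forall a, a != c -> a != f -> nats s' a =1 nats s a,
  reals s' = reals s, queries s' = queries s
  & nats s' f 0 = (\sum_(j < n) ((j < k) && t j))%N].
apply: runs_weaken (_ : runs _ _ _ (Inv n)).
  move=> s' [h1 h2 h3 h4]; apply: post => //; rewrite h4 -sum1_card [RHS]big_mkcond /=.
  by apply: eq_bigr => j _; rewrite ltn_ord inE; case: (t j).
apply: runs_for => //.
- by move=> k s' [h _ _ _]; rewrite h // eq_sym.
- move=> k v s' [h1 h2 h3 h4]; split=> //= [a ac af|].
    by move=> y; rewrite /= /update (negbTE ac) /= h1.
  by rewrite /update eq_sym (negbTE cf).
- move=> k s' kn [h1 h2 h3 h4] ck.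
  have e : teval s' b = t (Ordinal kn) by exact: bt.
  have sk := sum_ord_ltnS t (Ordinal kn); rewrite /= -e in sk.
  apply: runs_if => hb.
    apply: runs_setnat; split=> /=; last first.
      by rewrite /update (negbTE cf) /= ck.
    split=> //= [a ac af y|]; first by rewrite /update (negbTE af) /= h1.
    by rewrite /update !eqxx /= sk h4 hb.
  apply: runs_skip; split=> //; split=> //.
  by rewrite sk h4 (negbTE hb) addn0.
- split=> //= [a ac af y|]; first by rewrite /update (negbTE af).
  by rewrite /update !eqxx big1.
Qed.

End Loops.

(** * The program *)

(* Nat arrays: 0 input size, 1 output ranks, 2 flags of queried intervals,
   4 flags of innermost intervals, 5 innermost intervals by position (shifted by
   one, 0 when the position is void), 6 [mark], 7 [adj], 8 [sp], 9 [ep],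
   20-23 scratch cells. Real array 3 holds the true values of the queried
   intervals and the predictions of the others. *)
Definition var_i := Get 20 (Const 0).
Definition var_j := Get 21 (Const 0).
Definition var_f := Get 22 (Const 0).
Definition Neq e1 e2 := Not (And (NatLe e1 e2) (NatLe e2 e1)).
Definition Or b1 b2 := Not (And (Not b1) (Not b2)).
Definition Pos e := NatLe (Const 1) e.
Definition RealLt r1 e1 r2 e2 := Not (RealLe r2 e2 r1 e1).
Definition Inside e r e' := And (RealLt 0 e r e') (RealLt r e' 1 e).
Definition QueryCell e := Seq (Query e 3 e) (SetNat 2 e (Const 1)).

Definition copy_predictions := For 20 (SetReal 3 var_i 2 var_i).

Definition find_innermost :=
  For 20 (Seq
    (Count 21 22 (And (Neq var_j var_i) (And (RealLt 0 var_j 1 var_j)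
      (And (RealLe 0 var_i 0 var_j) (RealLe 1 var_j 1 var_i)))))
    (If (And (RealLt 0 var_i 1 var_i) (Not (Pos var_f)))
        (SetNat 4 var_i (Const 1)) Skip)).

Definition sort_innermost :=
  For 20 (If (Pos (Get 4 var_i))
    (Seq (Count 21 22 (And (Pos (Get 4 var_j)) (RealLt 0 var_j 0 var_i)))
         (SetNat 5 var_f (Add var_i (Const 1))))
    Skip).

Definition at_pos e := Defs.Sub (Get 5 e) (Const 1).
Definition prev e := Defs.Sub e (Const 1).

Definition compute_marks :=
  For 20 (If (And (Pos var_i) (And (Pos (Get 5 var_i)) (And (Pos (Get 5 (prev var_i)))
               (RealLt 0 (at_pos var_i) 1 (at_pos (prev var_i))))))
    (Seq (SetNat 7 var_i (Const 1))
         (SetNat 6 var_i (Defs.Sub (Const 1) (Get 6 (prev var_i)))))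
    Skip).

(** The predictions are also read from array 2, because a query overwrites array 3: a prediction
    mandatory interval has to be queried even if its trigger was queried first. *)
Definition close_pass :=
  For 20 (If (Not (Pos (Get 2 var_i)))
    (Seq (Count 21 22 (And (Neq var_j var_i)
                           (Or (Inside var_i 2 var_j) (Inside var_i 3 var_j))))
         (If (Pos var_f) (QueryCell var_i) Skip))
    Skip).

(** A pass that starts from a set that is not closed adds a query, so [n] passes suffice. *)
Definition close := For 23 close_pass.

Definition Linked e :=
  And (Pos (Get 7 e)) (And (Not (Pos (Get 2 (at_pos (prev e)))))
                           (Not (Pos (Get 2 (at_pos e))))).

Definition compute_starts :=
  For 20 (If (Linked var_i) (SetNat 8 var_i (Get 8 (prev var_i)))
                            (SetNat 8 var_i (Get 6 var_i))).

(** The values [ep] propagate from right to left, whereas [For] counts upwards. *)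
Definition from_end := Defs.Sub (Defs.Sub (Get 0 (Const 0)) (Const 1)) var_i.
Definition next e := Add e (Const 1).

Definition compute_ends :=
  For 20 (If (Linked (next from_end)) (SetNat 9 from_end (Get 9 (next from_end)))
                                      (SetNat 9 from_end (Get 6 from_end))).

(** The exclusive disjunction of the hypothesis [CE], written with the available tests. *)
Definition Chosen :=
  let a := Pos (Get 6 var_i) in
  let b := And (Pos (Get 8 var_i)) (Pos (Get 9 var_i)) in
  And (Not (And a b)) (Or a b).

Definition query_cover :=
  For 20 (If (And (Pos (Get 5 var_i)) (And (Not (Pos (Get 2 (at_pos var_i)))) Chosen))
             (QueryCell (at_pos var_i)) Skip).

Definition output_ranks :=
  For 20 (Seq (Count 21 22 (RealLt 3 var_j 3 var_i)) (SetNat 1 var_i var_f)).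

Definition sorting_program :=
  Seq copy_predictions (Seq find_innermost (Seq sort_innermost (Seq compute_marks
  (Seq close (Seq compute_starts (Seq compute_ends (Seq query_cover
  (Seq close output_ranks)))))))).

Definition frame (R : realFieldType) (n : nat) (ns rs : seq nat) (s s' : state R n) :=
  (forall a, a \notin ns -> nats s' a =1 nats s a) /\
  (forall r, r \notin rs -> reals s' r =1 reals s r).

Section Frames.
Variables (R : realFieldType) (n : nat).
Implicit Types (s : state R n) (ns rs : seq nat).

Lemma frame_refl ns rs s : frame ns rs s s.
Proof. by []. Qed.

Lemma frame_setnat ns rs s0 s a i v q : a \in ns -> frame ns rs s0 s ->
  frame ns rs s0 (State (update (nats s) a i v) (reals s) q).
Proof.
move=> an [h1 h2]; split=> // b bn y; rewrite /= /update.
by rewrite (_ : b == a = false) ?h1 //; apply: contraNF bn => /eqP->.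
Qed.

Lemma frame_setreal ns rs s0 s r i v q : r \in rs -> frame ns rs s0 s ->
  frame ns rs s0 (State (nats s) (update (reals s) r i v) q).
Proof.
move=> rn [h1 h2]; split=> // b bn y; rewrite /= /update.
by rewrite (_ : b == r = false) ?h2 //; apply: contraNF bn => /eqP->.
Qed.

Lemma frame_count ns rs s0 s s' c f : c \in ns -> f \in ns -> frame ns rs s0 s ->
  (forall a, a != c -> a != f -> nats s' a =1 nats s a) ->
  reals s' = reals s -> frame ns rs s0 s'.
Proof.
move=> cn fn [h1 h2] g1 g2; split; last by rewrite g2.
move=> a an y; rewrite g1 ?h1 //; apply: contraNneq an => ->; by [].
Qed.

Lemma frame_trans ns rs ns' rs' s0 s s' : frame ns rs s0 s -> frame ns' rs' s s' ->
  all (mem ns) ns' -> all (mem rs) rs' -> frame ns rs s0 s'.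
Proof.
move=> [h1 h2] [g1 g2] /allP nn /allP rr; split=> [a an|r rn] y.
  by rewrite g1 ?h1 //; apply: contra an => /nn.
by rewrite g2 ?h2 //; apply: contra rn => /rr.
Qed.

End Frames.

(** * Correctness of the phases of the program *)

Section Correctness.
Variables (R : realFieldType) (n : nat) (X : instance R n).
Notation I := (itv X).
Notation w := (true_value X).
Notation p := (predicted X).
Implicit Types (s : state R n) (Post : state R n -> Prop).

Let Lc := cell 0 (fun i => lower (I i)).
Let Uc := cell 0 (fun i => upper (I i)).
Let Pc := cell 0 p.

Definition base s := [/\ nats s 0 0 = n, reals s 0 =1 Lc, reals s 1 =1 Uc
  & reals s 2 =1 Pc].

Lemma cellE (T : Type) (d : T) (f : 'I_n -> T) (i : 'I_n) : cell d f i = f i.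
Proof. by rewrite /cell valK. Qed.

Lemma base_frame ns rs s s' : base s -> frame ns rs s s' -> 0%N \notin ns ->
  [&& 0%N \notin rs, 1%N \notin rs & 2%N \notin rs] -> base s'.
Proof.
move=> [b1 b2 b3 b4] [h1 h2] n0 /and3P[r0 r1 r2].
by split=> [|y|y|y]; rewrite ?h1 ?h2.
Qed.

Lemma base_n s : base s -> nats s 0 0 = n. Proof. by case. Qed.

Lemma ord_val_eq k (kn : (k < n)%N) (l : 'I_n) : l = k :> nat -> l = Ordinal kn.
Proof. by move=> e; apply: val_inj. Qed.

Lemma runs_copy_predictions s Post : base s ->
  (forall s', frame [:: 20] [:: 3] s s' -> queries s' = queries s ->
     (forall i : 'I_n, reals s' 3 i = p i) -> Post s') ->
  runs w copy_predictions s Post.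
Proof.
move=> bs post.
pose Inv k s' := [/\ frame [:: 20] [:: 3] s s', queries s' = queries s
  & forall i : 'I_n, (i < k)%N -> reals s' 3 i = p i].
apply: runs_weaken (_ : runs _ _ _ (Inv n)).
  by move=> s' [h1 h2 h3]; apply: post => // i; exact: h3.
apply: runs_for => //.
- by move=> k s' [h _ _]; apply: base_n; exact: base_frame bs h isT isT.
- by move=> k v s' [h1 h2 h3]; split=> //; exact: frame_setnat.
- move=> k s' kn [h1 h2 h3] ck; apply: runs_setreal; split=> //=; split=> //.
    exact: frame_setreal.
  move=> i ik /=; rewrite /update /= ck; case: eqP => [e|ne].
    have [_ _ _ b4] := base_frame bs h1 isT isT.
    by rewrite b4 -e /Pc cellE.
  by apply: h3; rewrite ltn_neqAle -ltnS ik andbT; exact/eqP.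
Qed.

Lemma runs_find_innermost s Post : base s -> (forall k, nats s 4 k = 0%N) ->
  (forall s', frame [:: 20; 21; 22; 4] [::] s s' -> queries s' = queries s ->
     (forall i : 'I_n, nats s' 4 i = innermost I i) -> Post s') ->
  runs w find_innermost s Post.
Proof.
move=> bs z4 post.
pose Inv k s' := [/\ frame [:: 20; 21; 22; 4] [::] s s', queries s' = queries s
  & forall i : 'I_n, nats s' 4 i = (i < k)%N && innermost I i].
apply: runs_weaken (_ : runs _ _ _ (Inv n)).
  by move=> s' [h1 h2 h3]; apply: post => // i; rewrite h3 ltn_ord.
apply: runs_for => //.
- by move=> k s' [h _ _]; apply: base_n; exact: base_frame bs h isT isT.
- by move=> k v s' [h1 h2 h3]; split=> //; exact: frame_setnat.
- move=> k s' kn [h1 h2 h3] ck.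
  have bs' := base_frame bs h1 isT isT.
  pose i := Ordinal kn.
  apply: runs_seq; apply: (@runs_count _ _ _ (fun j =>
    [&& j != i, nontrivial (I j), lower (I i) <= lower (I j)
      & upper (I j) <= upper (I i)])) => //; first exact: base_n.
    move=> s1 j f1 r1 cj; have [_ b2 b3 _] := bs'.
    rewrite /= cj f1 // ck r1 !b2 !b3 /Lc /Uc -[k]/(val i) !cellE.
    by rewrite -eqn_leq -val_eqE -ltNge.
  move=> s1 f1 r1 q1 cnt.
  have fr1 : frame [:: 20; 21; 22; 4] [::] s s1 by exact: frame_count h1 f1 r1.
  have [_ b2 b3 _] := base_frame bs fr1 isT isT.
  have ck1 : nats s1 20 0 = k by rewrite f1.
  have z1 (l : 'I_n) : nats s1 4 l = (l < k)%N && innermost I l by rewrite f1.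
  have tst : (teval s1 (And (RealLt 0 var_i 1 var_i) (Not (Pos var_f)))) = innermost I i.
    rewrite /= ck1 b2 b3 /Lc /Uc -[k]/(val i) !cellE -ltNge cnt.
    rewrite /innermost /nontrivial; congr (_ && _).
    by rewrite card_gt0; congr (~~ _); apply/set0Pn/existsP => -[j];
      [rewrite inE => h|move=> h]; exists j; rewrite ?inE.
  apply: runs_if; rewrite tst => hin.
    apply: runs_setnat => /=; split=> //; split=> //; first exact: frame_setnat.
      by rewrite q1.
    move=> l /=; rewrite /update /= ck1 z1.
    case: eqP => [e|ne]; first by rewrite (ord_val_eq kn e) hin ltnSn.
    by rewrite ltnS [(l <= k)%N]leq_eqVlt (introF eqP ne).
  apply: runs_skip; split=> //; split=> //; first by rewrite q1.
  move=> l; rewrite z1 ltnS [(l <= k)%N]leq_eqVlt; case: (l =P k :> nat) => // e.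
  have -> := ord_val_eq kn e.
  by rewrite (negbTE hin) !andbF.
Qed.

Definition pos (i : 'I_n) : nat :=
  #|[set j | innermost I j && (lower (I j) < lower (I i))]|.

(** Of two intervals with the same left endpoint, one contains the other. *)
Lemma innermost_lower_inj i j : innermost I i -> innermost I j ->
  lower (I i) = lower (I j) -> i = j.
Proof.
wlog uu : i j / upper (I i) <= upper (I j).
  move=> h ii ij e; case/orP: (le_total (upper (I i)) (upper (I j))) => u.
    exact: h.
  by apply/esym/h.
move=> ii /andP[_ nj] e; apply/eqP; apply: contraNT nj => ij; apply/existsP; exists i.
by rewrite ij (innermost_nontrivial ii) e lexx uu.
Qed.

Lemma pos_lt i j : innermost I i -> lower (I i) < lower (I j) -> (pos i < pos j)%N.
Proof.
move=> ii ij; apply: proper_card; apply/properP; split.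
  by apply/subsetP=> k; rewrite !inE => /andP[-> /lt_trans->].
by exists i; rewrite !inE ii ?ij // ltxx.
Qed.

Lemma pos_inj i j : innermost I i -> innermost I j -> pos i = pos j -> i = j.
Proof.
move=> ii ij e; apply: innermost_lower_inj => //.
case: (ltgtP (lower (I i)) (lower (I j))) => // h.
  by have := pos_lt ii h; rewrite e ltnn.
by have := pos_lt ij h; rewrite e ltnn.
Qed.

Definition is_position_array (o : nat -> nat) : Prop :=
  (forall i : 'I_n, innermost I i -> o (pos i) = i.+1) /\
  (forall l, (0 < o l)%N -> exists2 i : 'I_n, innermost I i & pos i = l /\ o l = i.+1).

Lemma runs_sort_innermost s Post : base s -> (forall k, nats s 5 k = 0%N) ->
  (forall i : 'I_n, nats s 4 i = innermost I i) ->
  (forall s', frame [:: 20; 21; 22; 5] [::] s s' -> queries s' = queries s ->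
     is_position_array (nats s' 5) -> Post s') ->
  runs w sort_innermost s Post.
Proof.
move=> bs z5 g4 post.
pose Inv k s' := [/\ frame [:: 20; 21; 22; 5] [::] s s', queries s' = queries s,
  (forall i : 'I_n, (i < k)%N -> innermost I i -> nats s' 5 (pos i) = i.+1)
  & (forall l, (0 < nats s' 5 l)%N ->
       exists2 i : 'I_n, innermost I i & pos i = l /\ nats s' 5 l = i.+1)].
apply: runs_weaken (_ : runs _ _ _ (Inv n)).
  by move=> s' [h1 h2 h3 h4]; apply: post => //; split=> // i; exact: h3.
apply: runs_for => //.
- by move=> k s' [h _ _ _]; apply: base_n; exact: base_frame bs h isT isT.
- by move=> k v s' [h1 h2 h3 h4]; split=> //; exact: frame_setnat.
- move=> k s' kn [h1 h2 h3 h4] ck.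
  have bs' := base_frame bs h1 isT isT.
  pose i := Ordinal kn.
  have g4' (l : 'I_n) : nats s' 4 l = innermost I l by rewrite h1.1.
  apply: runs_if; rewrite /= ck -[k]/(val i) g4' lt0b => hin; last first.
    apply: runs_skip; split=> //; split=> // l; rewrite ltnS leq_eqVlt.
    move=> /orP[/eqP e lin|]; last exact: h3.
    by move: lin; rewrite (ord_val_eq kn e) (negbTE hin).
  apply: runs_seq; apply: (@runs_count _ _ _ (fun j =>
    innermost I j && (lower (I j) < lower (I i)))) => //; first exact: base_n.
    move=> s1 j f1 r1 cj; have [_ b2 _ _] := bs'.
    rewrite /= cj !f1 // ck r1 !b2 /Lc -[k]/(val i) !cellE g4' lt0b.
    by rewrite -ltNge.
  move=> s1 f1 r1 q1 cnt; rewrite -/(pos i) in cnt.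
  have fr1 : frame [:: 20; 21; 22; 5] [::] s s1 by exact: frame_count h1 f1 r1.
  have ck1 : nats s1 20 0 = k by rewrite f1.
  apply: runs_setnat => /=; split=> //; split=> //.
  + exact: frame_setnat.
  + by rewrite q1.
  + move=> l lk lin /=; rewrite /update /= cnt ck1 addn1.
    case: eqP => [e|ne]; first by rewrite (pos_inj lin hin e).
    rewrite f1 // h3 // ltn_neqAle -ltnS lk andbT.
    by apply: contra_notN ne => /eqP e; rewrite (ord_val_eq kn e).
  + move=> l /=; rewrite /update /= cnt ck1 addn1; case: eqP => [-> _|ne].
      by exists i.
    by rewrite f1 // => /h4.
- by split=> // l; rewrite z5.
Qed.

Definition adj_at (o : nat -> nat) (l : nat) : bool :=
  [&& (0 < l)%N, (0 < o l)%N, (0 < o l.-1)%N & Lc (o l).-1 < Uc (o l.-1).-1].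

Lemma runs_compute_marks s Post : base s ->
  (forall k, nats s 6 k = 0%N) -> (forall k, nats s 7 k = 0%N) ->
  (forall s', frame [:: 20; 6; 7] [::] s s' -> queries s' = queries s ->
     (forall l, nats s' 7 l = (l < n)%N && adj_at (nats s 5) l) ->
     (forall l, (l < n)%N ->
        (0 < nats s' 6 l)%N = adj_at (nats s 5) l && ~~ (0 < nats s' 6 l.-1)%N) ->
     Post s') ->
  runs w compute_marks s Post.
Proof.
move=> bs z6 z7 post.
pose Inv k s' := [/\ frame [:: 20; 6; 7] [::] s s', queries s' = queries s,
  (forall l, nats s' 7 l = (l < k)%N && adj_at (nats s 5) l),
  (forall l, (l < k)%N ->
     (0 < nats s' 6 l)%N = adj_at (nats s 5) l && ~~ (0 < nats s' 6 l.-1)%N)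
  & (forall l, (k <= l)%N -> nats s' 6 l = 0%N)].
apply: runs_weaken (_ : runs _ _ _ (Inv n)).
  by move=> s' [h1 h2 h3 h4 h5]; apply: post.
apply: runs_for => //.
- by move=> k s' [h _ _ _ _]; apply: base_n; exact: base_frame bs h isT isT.
- by move=> k v s' [h1 h2 h3 h4 h5]; split=> //; exact: frame_setnat.
- move=> k s' kn [h1 h2 h3 h4 h5] ck.
  have [_ b2 b3 _] := base_frame bs h1 isT isT.
  have o5 : nats s' 5 =1 nats s 5 by apply: h1.1.
  apply: runs_if; rewrite /= ck !o5 !subn1 b2 b3 -ltNge -/(adj_at _ _) => ha.
    apply: runs_seq; apply: runs_setnat; apply: runs_setnat; rewrite /= ck.
    have e20 : update (nats s') 7 k 1%N 20 0 = k := ck.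
    rewrite e20 subn1 [update _ 7 _ _ 6 _]/=; split=> //; split=> //.
    + apply: (@frame_setnat _ _ _ _ _ (State (update (nats s') 7 k 1%N) _ (queries s'))) => //.
      exact: frame_setnat.
    + move=> l /=; case: (ltngtP l k) => [lk|lk|->].
      * by rewrite /update /= (ltn_eqF lk) h3 ltnS lk (ltnW lk).
      * have lk1 : (l < k)%N = false by rewrite ltnNge (ltnW lk).
        have lk2 : (l < k.+1)%N = false by rewrite ltnS leqNgt lk.
        by rewrite /update /= (gtn_eqF lk) h3 lk1 lk2.
      * by rewrite /update /= eqxx ltnSn ha.
    + have k0 : (0 < k)%N by case/and4P: ha.
      move=> l; rewrite ltnS leq_eqVlt => /orP[/eqP->|lk]; rewrite /update /=.
        by rewrite eqxx (ltn_eqF (_ : (k.-1 < k)%N)) ?prednK // ha subn_gt0 ltnS leqn0 lt0n negbK.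
      by rewrite (ltn_eqF lk) (ltn_eqF (leq_ltn_trans (leq_pred l) lk)) h4.
    + by move=> l kl; rewrite /update /= (gtn_eqF kl) h5 // ltnW.
  apply: runs_skip; split=> //; split=> //.
  + move=> l; rewrite h3 ltnS [(l <= k)%N]leq_eqVlt.
    by case: eqP => //= ->; rewrite (negbTE ha) andbF.
  + move=> l; rewrite ltnS leq_eqVlt => /orP[/eqP->|]; last exact: h4.
    by rewrite (negbTE ha) h5.
  + by move=> l kl; rewrite h5 // ltnW.
Qed.

(** Array 3 thereby always holds a value assignment consistent with the answers, which is what the
    output phase ranks. *)
Definition qinv s := [/\ uniq (queries s),
  forall i : 'I_n, nats s 2 i = (i \in queries s)
  & forall i : 'I_n, reals s 3 i = if i \in queries s then w i else p i].

Lemma qinv_frame ns rs s s' : qinv s -> frame ns rs s s' ->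
  queries s' = queries s -> 2%N \notin ns -> 3%N \notin rs -> qinv s'.
Proof.
by move=> [h1 h2 h3] [f1 f2] q a2 a3; split=> [|i|i]; rewrite q ?f1 ?f2.
Qed.

Lemma runs_query_cell e (i : 'I_n) s Post : neval (nats s) e = i ->
  i \notin queries s -> qinv s ->
  (forall s', frame [:: 2] [:: 3] s s' -> qinv s' ->
     queries s' = i :: queries s -> Post s') ->
  runs w (QueryCell e) s Post.
Proof.
move=> ei iq [h1 h2 h3] post.
apply: runs_seq; apply: (runs_query ei); apply: runs_setnat => /=.
rewrite ei; apply: post => //.
  split=> /= [a|r]; rewrite inE => ha y; rewrite /update (negbTE ha) //.
split=> /= [|j|j]; rewrite ?iq // /update /= inE val_eqE.
  by case: eqP => // _; rewrite h2.
by case: eqP => [->|_] //; rewrite h3.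
Qed.

Definition addable s (i j : 'I_n) : bool :=
  inside (I i) (p j) || (j \in queries s) && inside (I i) (w j).

Definition closed s := forall i j : 'I_n, j != i -> addable s i j -> i \in queries s.

Definition justified s0 s := forall i : 'I_n, i \in queries s -> i \notin queries s0 ->
  exists2 j, j != i & addable s i j.

Lemma addable_sub s s' i j : {subset queries s <= queries s'} ->
  addable s i j -> addable s' i j.
Proof. by move=> h /orP[|/andP[/h]]; rewrite /addable => -> // ->; rewrite orbT. Qed.

(** A pass without queries has tested every interval against an unchanged set of answers and so
    certifies closure; any other pass makes progress. *)
Lemma runs_close_pass s Post : base s -> qinv s ->
  (forall s', frame [:: 20; 21; 22; 2] [:: 3] s s' -> qinv s' ->
     {subset queries s <= queries s'} -> justified s s' ->
     (queries s' = queries s /\ closed s') \/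
     ((size (queries s) < size (queries s'))%N /\ ~ closed s) -> Post s') ->
  runs w close_pass s Post.
Proof.
move=> bs qs post.
pose Inv k s' := [/\ frame [:: 20; 21; 22; 2] [:: 3] s s', qinv s',
  {subset queries s <= queries s'}, justified s s' &
  (queries s' = queries s /\ forall i : 'I_n, (i < k)%N -> i \notin queries s ->
     forall j, j != i -> ~~ addable s i j) \/
  ((size (queries s) < size (queries s'))%N /\ ~ closed s)].
apply: runs_weaken (_ : runs _ _ _ (Inv n)).
  move=> s' [h1 h2 h3 h4 h5]; apply: post => //; case: h5 => [[e h]|h]; last by right.
  left; split=> // i j ji; rewrite /addable e => had; apply: contraTT had => iq.
  exact: h.
apply: runs_for => //.
- by move=> k s' [h _ _ _ _]; apply: base_n; exact: base_frame bs h isT isT.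
- move=> k v s' [h1 h2 h3 h4 h5]; split=> //; first exact: frame_setnat.
- move=> k s' kn [h1 h2 h3 h4 h5] ck.
  have bs' := base_frame bs h1 isT isT.
  pose i := Ordinal kn; have [u2 f2 v2] := h2.
  have next : (forall j, i \notin queries s -> queries s' = queries s -> j != i ->
      ~~ addable s i j) -> Inv k.+1 s'.
    move=> hi; split=> //; case: h5 => [[e h]|]; [left|by right].
    split=> // l; rewrite ltnS leq_eqVlt => /orP[/eqP el lq j|]; last exact: h.
    by rewrite (ord_val_eq kn el) in lq *; exact: hi.
  apply: runs_if; rewrite /= ck -[k]/(val i) f2 lt0b => iq; last first.
    apply: runs_skip; split=> //; apply: next => j iq' e.
    by rewrite e (negbTE iq') in iq.
  apply: runs_seq; apply: (@runs_count _ _ _ (fun j => (j != i) && addable s' i j)) => //.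
  + exact: base_n.
  + move=> s1 j f1 r1 cj; have [_ b2 b3 b4] := bs'.
    rewrite /= cj f1 // ck r1 !b2 !b3 !b4 /Lc /Uc /Pc -[k]/(val i) !cellE v2.
    rewrite -!ltNge -eqn_leq -val_eqE /addable /inside; congr (_ && _).
    by case: (j \in queries s') => /=; rewrite -negb_or negbK ?orbb ?orbF.
  move=> s1 f1 r1 q1 cnt.
  have fr1 : frame [:: 20; 21; 22; 2] [:: 3] s s1 by exact: frame_count h1 f1 r1.
  have fr2 : frame [:: 21; 22] [::] s' s1 by exact: frame_count (frame_refl _ _ _) f1 r1.
  have qs1 := qinv_frame h2 fr2 q1 isT isT.
  have ck1 : nats s1 20 0 = k by rewrite f1.
  apply: runs_if; rewrite /= cnt card_gt0 => hc.
    have [j] := set0Pn _ hc; rewrite inE => /andP[ji had].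
    apply: (@runs_query_cell _ i) => //; first by rewrite q1.
    move=> s2 fr3 qs2 q2; have sub : {subset queries s' <= queries s2}.
      by move=> l lq; rewrite q2 inE q1 lq orbT.
    split; last by rewrite fr3.1.
    split=> //.
    + exact: frame_trans fr1 fr3 isT isT.
    + by move=> l /h3/sub.
    + move=> l; rewrite q2 inE q1 => /orP[/eqP-> _|lq lq0].
        by exists j => //; exact: addable_sub had.
      by have [j' ? ?] := h4 l lq lq0; exists j' => //; exact: addable_sub sub _.
    + right; rewrite q2 /= q1; case: h5 => [[e h]|[h hn]]; last first.
        by split=> //; exact: ltnW.
      split; first by rewrite e.
      move=> cl; have : i \in queries s.
        by apply: cl ji _; rewrite /addable -e.
      by rewrite -e (negbTE iq).
  apply: runs_skip; split=> //.
  have nx : Inv k.+1 s'.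
    apply: next => j iqs e ji; apply/negP=> had.
    move/negP: hc; apply; apply/set0Pn; exists j; rewrite inE ji.
    by rewrite /addable e.
  have [_ _ n3 n4 n5] := nx; split=> //; rewrite ?q1 //.
  by move=> l lq lq0; rewrite q1 in lq; have [j ? ?] := n4 l lq lq0; exists j => //;
    rewrite /addable q1.
- by split=> //; [move=> i ->|left].
Qed.

Lemma runs_close s Post : base s -> qinv s ->
  (forall s', frame [:: 20; 21; 22; 23; 2] [:: 3] s s' -> qinv s' ->
     {subset queries s <= queries s'} -> justified s s' -> closed s' -> Post s') ->
  runs w close s Post.
Proof.
move=> bs qs post.
pose Inv r s' := [/\ frame [:: 20; 21; 22; 23; 2] [:: 3] s s', qinv s',
  {subset queries s <= queries s'}, justified s s' &
  closed s' \/ (r <= size (queries s'))%N].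
apply: runs_weaken (_ : runs _ _ _ (Inv n)).
  (* If no pass has reached closure, there are at least [n] distinct queries, so everything is
     queried and closure is trivial. *)
  move=> s' [h1 h2 h3 h4 h5]; apply: post => //; case: h5 => // hs i j _ _.
  have [u _ _] := h2.
  have := uniq_min_size u (s2 := enum 'I_n); rewrite size_enum_ord.
  move=> /(_ (fun l _ => mem_enum 'I_n l) hs)[_ e].
  by rewrite e mem_enum.
apply: runs_for => //.
- by move=> k s' [h _ _ _ _]; apply: base_n; exact: base_frame bs h isT isT.
- by move=> k v s' [h1 h2 h3 h4 h5]; split=> //; exact: frame_setnat.
- move=> k s' kn [h1 h2 h3 h4 h5] ck.
  have bs' := base_frame bs h1 isT isT.
  apply: runs_close_pass => // s1 fr1 q1 sub1 j1 prog.
  split; last by rewrite fr1.1.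
  split=> //.
  + exact: frame_trans h1 fr1 isT isT.
  + by move=> l /h3/sub1.
  + move=> l lq lq0; have [lq'|lq'] := boolP (l \in queries s').
      by have [j ? ?] := h4 l lq' lq0; exists j => //; exact: addable_sub sub1 _.
    exact: j1.
  + case: prog => [[_ cl]|[lt ncl]]; first by left.
    by right; case: h5 => // h; exact: leq_ltn_trans h lt.
- by split=> //; [move=> i ->|right].
Qed.

Definition link_at (a o q : nat -> nat) (l : nat) : bool :=
  [&& (0 < a l)%N, ~~ (0 < q (o l.-1).-1)%N & ~~ (0 < q (o l).-1)%N].

Lemma runs_compute_starts s Post : base s -> nats s 7 0 = 0%N ->
  (forall s', frame [:: 20; 8] [::] s s' -> queries s' = queries s ->
     (forall l, (l < n)%N -> nats s' 8 l =
        if link_at (nats s 7) (nats s 5) (nats s 2) l then nats s' 8 l.-1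
        else nats s 6 l) -> Post s') ->
  runs w compute_starts s Post.
Proof.
move=> bs z7 post.
pose Inv k s' := [/\ frame [:: 20; 8] [::] s s', queries s' = queries s &
  forall l, (l < k)%N -> nats s' 8 l =
        if link_at (nats s 7) (nats s 5) (nats s 2) l then nats s' 8 l.-1
        else nats s 6 l].
apply: runs_weaken (_ : runs _ _ _ (Inv n)); first by move=> s' [*]; exact: post.
apply: runs_for => //.
- by move=> k s' [h _ _]; apply: base_n; exact: base_frame bs h isT isT.
- by move=> k v s' [h1 h2 h3]; split=> //; exact: frame_setnat.
- move=> k s' kn [h1 h2 h3] ck; have f := h1.1.
  have step v : (link_at (nats s 7) (nats s 5) (nats s 2) k -> v = nats s' 8 k.-1) ->
      (~~ link_at (nats s 7) (nats s 5) (nats s 2) k -> v = nats s 6 k) ->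
      Inv k.+1 (State (update (nats s') 8 k v) (reals s') (queries s')).
    move=> v1 v2; split=> //; first exact: frame_setnat.
    move=> l; rewrite ltnS leq_eqVlt => /orP[/eqP->|lk]; rewrite /= /update /=.
      rewrite eqxx; case: ifP => [hl|/negbT/v2//].
      (* At position 0 the truncated predecessor would be the position itself; the zero in cell 0 of
         array 7 excludes a link there. *)
      have k0 : (0 < k)%N by rewrite lt0n; apply: contraTneq hl => ->; rewrite /link_at z7.
      by rewrite (ltn_eqF (_ : (k.-1 < k)%N)) ?prednK // v1.
    by rewrite (ltn_eqF lk) (ltn_eqF (leq_ltn_trans (leq_pred l) lk)) h3.
  apply: runs_if; rewrite /= ck !f // !subn1 -/(link_at _ _ _ _) => hl;
    apply: runs_setnat; rewrite /= ck ?subn1; split=> //.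
    by apply: step => //; rewrite hl.
  by apply: step => [|_]; [rewrite (negbTE hl)|rewrite f].
Qed.

Lemma runs_compute_ends s Post : base s ->
  (forall s', frame [:: 20; 9] [::] s s' -> queries s' = queries s ->
     (forall l, (l < n)%N -> nats s' 9 l =
        if link_at (nats s 7) (nats s 5) (nats s 2) l.+1 then nats s' 9 l.+1
        else nats s 6 l) -> Post s') ->
  runs w compute_ends s Post.
Proof.
move=> bs post.
pose Inv k s' := [/\ frame [:: 20; 9] [::] s s', queries s' = queries s &
  forall l, (n - k <= l < n)%N -> nats s' 9 l =
        if link_at (nats s 7) (nats s 5) (nats s 2) l.+1 then nats s' 9 l.+1
        else nats s 6 l].
apply: runs_weaken (_ : runs _ _ _ (Inv n)).
  by move=> s' [h1 h2 h3]; apply: post => // l ln; apply: h3; rewrite subnn ln.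
apply: runs_for => //.
- by move=> k s' [h _ _]; apply: base_n; exact: base_frame bs h isT isT.
- by move=> k v s' [h1 h2 h3]; split=> //; exact: frame_setnat.
- move=> k s' kn [h1 h2 h3] ck; have f := h1.1.
  have n0 := base_n (base_frame bs h1 isT isT).
  set e := (n - 1 - k)%N.
  have step v : (link_at (nats s 7) (nats s 5) (nats s 2) e.+1 -> v = nats s' 9 e.+1) ->
      (~~ link_at (nats s 7) (nats s 5) (nats s 2) e.+1 -> v = nats s 6 e) ->
      Inv k.+1 (State (update (nats s') 9 e v) (reals s') (queries s')).
    move=> v1 v2; split=> //; first exact: frame_setnat.
    move=> l lk; rewrite /= /update /=.
    have [->|ne] := eqVneq l e.
      by rewrite (gtn_eqF (ltnSn e)); case: ifP => [/v1//|/negbT/v2//].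
    have el : (e < l)%N by move: lk ne kn; rewrite /e; clear; lia.
    rewrite (gtn_eqF (leqW el)) h3 //.
    by move: lk el kn; rewrite /e; clear; lia.
  apply: runs_if; rewrite /= ck n0 !f // -/e !addn1 subn1 /= !subn1 -/(link_at _ _ _ e.+1) => hl;
    apply: runs_setnat; rewrite /= ck n0 -/e ?addn1; split=> //.
    by apply: step => //; rewrite hl.
  by apply: step => [|_]; [rewrite (negbTE hl)|rewrite f].
- by split=> // l; move: (l) => l'; clear; lia.
Qed.

Definition chosen_at (m a b : nat -> nat) (l : nat) : bool :=
  (0 < m l)%N != ((0 < a l)%N && (0 < b l)%N).

Lemma runs_query_cover s Post : base s -> qinv s -> is_position_array (nats s 5) ->
  (forall s', frame [:: 20; 2] [:: 3] s s' -> qinv s' ->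
     (forall i : 'I_n, (i \in queries s') = (i \in queries s) ||
        [exists l : 'I_n, (nats s 5 l == i.+1) &&
           chosen_at (nats s 6) (nats s 8) (nats s 9) l]) -> Post s') ->
  runs w query_cover s Post.
Proof.
move=> bs qs [_ o2] post.
pose ch := chosen_at (nats s 6) (nats s 8) (nats s 9).
pose Inv k s' := [/\ frame [:: 20; 2] [:: 3] s s', qinv s' &
  forall i : 'I_n, (i \in queries s') = (i \in queries s) ||
        [exists l : 'I_n, [&& (l < k)%N, nats s 5 l == i.+1 & ch l]]].
apply: runs_weaken (_ : runs _ _ _ (Inv n)).
  move=> s' [h1 h2 h3]; apply: post => // i; rewrite h3; congr (_ || _).
  by apply: eq_existsb => l; rewrite ltn_ord.
apply: runs_for => //.
- by move=> k s' [h _ _]; apply: base_n; exact: base_frame bs h isT isT.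
- by move=> k v s' [h1 h2 h3]; split=> //; exact: frame_setnat.
- move=> k s' kn [h1 h2 h3] ck; have f := h1.1; have [u2 f2 v2] := h2.
  have exS (i : 'I_n) : [exists l : 'I_n, [&& (l < k.+1)%N, nats s 5 l == i.+1 & ch l]] =
      [exists l : 'I_n, [&& (l < k)%N, nats s 5 l == i.+1 & ch l]] ||
      (nats s 5 k == i.+1) && ch k.
    apply/existsP/orP.
      move=> [l /and3P[]]; rewrite ltnS leq_eqVlt => /orP[/eqP->|lk] hl1 hl2.
        by right; rewrite hl1.
      by left; apply/existsP; exists l; rewrite lk hl1.
    move=> [/existsP[l /and3P[lk hl1 hl2]]|/andP[hl1 hl2]].
      by exists l; rewrite hl1 hl2 (ltnW (lk : (l.+1 < k.+1)%N)).
    by exists (Ordinal kn); rewrite /= ltnSn hl1.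
  have chE : teval s' Chosen = ch k.
    rewrite /= ck !f // /ch /chosen_at.
    by case: (0 < nats s 6 k)%N; case: (0 < nats s 8 k)%N; case: (0 < nats s 9 k)%N.
  have testE : teval s' (And (Pos (Get 5 var_i))
      (And (Not (Pos (Get 2 (at_pos var_i)))) Chosen)) =
      [&& (0 < nats s 5 k)%N, ~~ (0 < nats s' 2 (nats s 5 k).-1)%N & ch k].
    by rewrite -chE /= ck !(f 5) // subn1.
  apply: runs_if; rewrite testE.
    move=> /and3P[ok nq hc]; have [i _ [_ oi]] := o2 _ ok.
    rewrite oi /= f2 lt0b in nq.
    apply: (@runs_query_cell _ i) => //; first by rewrite /= ck f // oi subn1.
    move=> s2 fr2 qs2 q2; split; last by rewrite fr2.1.
    split=> //; first exact: frame_trans h1 fr2 isT isT.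
    move=> j; rewrite q2 inE h3 exS hc oi eqSS val_eqE andbT eq_sym.
    by rewrite orbC orbA.
  move=> hn; apply: runs_skip; split=> //; split=> // j.
  rewrite h3 exS orbA -h3; case: (boolP (j \in queries s')) => // jq.
  apply/esym/negP=> /andP[/eqP oj hc]; move/negP: hn; apply.
  by rewrite oj hc /= f2 (negbTE jq).
- split=> // i; rewrite (_ : [exists _, _] = false) ?orbF //.
  by apply/existsP=> -[].
Qed.

Lemma runs_output_ranks s Post : base s ->
  (forall s', queries s' = queries s ->
     (forall i : 'I_n, nats s' 1 i = #|[set j : 'I_n | reals s 3 (val j) < reals s 3 (val i)]|) ->
     Post s') ->
  runs w output_ranks s Post.
Proof.
move=> bs post.
pose Inv k s' := [/\ frame [:: 20; 21; 22; 1] [::] s s', queries s' = queries s &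
  forall i : 'I_n, (i < k)%N ->
    nats s' 1 i = #|[set j : 'I_n | reals s 3 (val j) < reals s 3 (val i)]|].
apply: runs_weaken (_ : runs _ _ _ (Inv n)).
  by move=> s' [h1 h2 h3]; apply: post => // i; exact: h3.
apply: runs_for => //.
- by move=> k s' [h _ _]; apply: base_n; exact: base_frame bs h isT isT.
- by move=> k v s' [h1 h2 h3]; split=> //; exact: frame_setnat.
- move=> k s' kn [h1 h2 h3] ck; have bs' := base_frame bs h1 isT isT.
  apply: runs_seq; apply: (@runs_count _ _ _ (fun j : 'I_n =>
    reals s 3 (val j) < reals s 3 k)) => //; first exact: base_n.
    by move=> s1 j f1 r1 cj; rewrite /= cj f1 // ck r1 !h1.2 // -ltNge.
  move=> s1 f1 r1 q1 cnt.
  have fr1 : frame [:: 20; 21; 22; 1] [::] s s1 by exact: frame_count h1 f1 r1.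
  apply: runs_setnat => /=; rewrite f1 // ck cnt; split; last by rewrite /update /= f1.
  split=> //; first exact: frame_setnat.
    by rewrite q1.
  move=> i; rewrite ltnS leq_eqVlt => /orP[/eqP e|ik]; rewrite /= /update /=.
    by rewrite -e eqxx.
  by rewrite (ltn_eqF ik) f1 // h3.
Qed.

End Correctness.

(** * From arrays to intervals *)

(** An interval in the symmetric difference contains exactly one of the true and the predicted value
    of some other interval, which therefore passes over one of its endpoints. Exchanging the sums
    charges the hop to the interval passed over. *)
Lemma k_M_le_k_h (R : realFieldType) (n : nat) (X : instance R n) :
  (k_M X <= k_h X)%N.
Proof.
have hop i u v : inside (itv X i) u -> ~~ inside (itv X i) v ->
    (0 < hops u v (itv X i))%N /\ (0 < hops v u (itv X i))%N.
  rewrite /inside; case: (itv X i) => [l r|y] /=.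
    move=> /andP[lu ur]; rewrite negb_and -!leNgt /passes_lower /passes_upper.
    by case/orP=> ->; rewrite ?lu ?ur ?orbT //= !addn_gt0 ?lt0b ?orbT.
  by move=> /andP[h1 h2]; have := lt_trans h1 h2; rewrite ltxx.
rewrite /k_M /k_h (mandatoryE (predictedP X)) (mandatoryE (true_valueP X)).
rewrite exchange_big -sum1_card big_mkcond /=; apply: leq_sum => i _.
case: ifP => // hi.
suff [j hj] : exists j, (0 < hops (true_value X j) (predicted X j) (itv X i))%N.
  by rewrite (bigD1 j) //= (leq_trans hj) // leq_addr.
have notin v j : i \notin value_mandatory (itv X) v -> j != i ->
    ~~ inside (itv X i) (v j).
  by move=> h ji; apply: contra h => h; apply/value_mandatoryP; exists j.
move: hi; rewrite in_setU !in_setD => /orP[] /andP[nh /value_mandatoryP[j ji hj]].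
  by exists j; have [] := hop _ _ _ hj (notin _ _ nh ji).
by exists j; have [] := hop _ _ _ hj (notin _ _ nh ji).
Qed.

Section Positions.
Variables (R : realFieldType) (n : nat) (X : instance R n).
Notation I := (itv X).
Notation w := (true_value X).
Notation p := (predicted X).
Variables (o : nat -> nat) (i0 : 'I_n).
Hypothesis oP : is_position_array X o.

Let G := [set i | innermost I i].
Let m := #|G|.
Let x l : 'I_n := insubd i0 (o l).-1.

Lemma pos_lt_card i : innermost I i -> (pos X i < m)%N.
Proof.
move=> ii; apply: proper_card; apply/properP; split.
  by apply/subsetP=> j; rewrite !inE => /andP[].
by exists i; rewrite !inE ?ii // ltxx andbF.
Qed.

Lemma at_posK i : innermost I i -> x (pos X i) = i.
Proof. by move=> ii; apply: val_inj; rewrite /x oP.1 //= val_insubd ltn_ord. Qed.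

(** [pos] maps the [m] innermost intervals injectively into [m] positions. *)
Lemma pos_onto k : (k < m)%N -> exists2 i, innermost I i & pos X i = k.
Proof.
move=> km; pose f i : 'I_m := insubd (Ordinal km) (pos X i).
have fE i : innermost I i -> f i = pos X i :> nat.
  by move=> ii; rewrite /f val_insubd pos_lt_card.
have finj : {in G &, injective f}.
  move=> i j; rewrite !inE => ii ij /(congr1 val) /=; rewrite !fE //.
  exact: pos_inj.
have fT : f @: G = [set: 'I_m].
  by apply/eqP; rewrite eqEcard subsetT cardsT card_ord (card_in_imset finj) /= leqnn.
have : Ordinal km \in f @: G by rewrite fT inE.
by case/imsetP=> i; rewrite inE => ii e; exists i => //; rewrite -fE // -e.
Qed.

Lemma position_array_at k : (k < m)%N -> o k = (x k).+1 /\ innermost I (x k).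
Proof.
by move=> /pos_onto[i ii <-]; rewrite at_posK // oP.1.
Qed.

Lemma position_array_void k : (0 < o k)%N = (k < m)%N.
Proof.
apply/idP/idP => [/oP.2[i ii [<- _]]|/position_array_at[->]//].
exact: pos_lt_card.
Qed.

Lemma at_pos_onto i : innermost I i -> exists2 k, (k < m)%N & x k = i.
Proof. by move=> ii; exists (pos X i); [exact: pos_lt_card|exact: at_posK]. Qed.

Lemma at_pos_lt k l : (k < l < m)%N -> lower (I (x k)) < lower (I (x l)).
Proof.
move=> /andP[kl lm]; have [i ii ei] := pos_onto (ltn_trans kl lm).
have [j ij ej] := pos_onto lm; rewrite -ei -ej !at_posK // ltNge le_eqVlt.
apply/negP=> /orP[/eqP/innermost_lower_inj e|/pos_lt].
  by move: kl; rewrite -ei -ej e // ltnn.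
by move=> /(_ ij); rewrite ei ej ltnNge (ltnW kl).
Qed.

Lemma positions_le_n : (m <= n)%N.
Proof. by rewrite -[n in (_ <= n)%N]card_ord max_card. Qed.

Lemma adj_atE l : adj_at X o l = adj I m x l.
Proof.
rewrite /adj_at /adj !position_array_void.
case: l => [|l] //=; case lm : (l.+1 < m)%N => //=.
have [-> _] := position_array_at lm; have [-> _] := position_array_at (ltnW lm).
by rewrite (ltnW lm) !cellE.
Qed.

Variables (a q : nat -> nat) (B : {set 'I_n}).
Hypothesis aP : forall l, a l = (l < n)%N && adj_at X o l.
Hypothesis qP : forall i : 'I_n, q i = (i \in B).

Lemma link_atE l : link_at a o q l = link I m x B l.
Proof.
rewrite /link_at /link aP adj_atE lt0b.
case al: (adj I m x l); rewrite ?andbF //= andbT.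
have [l0 lm l1m] := adj_lt al; rewrite (leq_trans lm positions_le_n) /=.
have [-> _] := position_array_at lm; have [-> _] := position_array_at l1m.
by rewrite !qP !lt0b.
Qed.

Variables mk sp ep : nat -> nat.
Hypothesis mkP : forall l, (l < n)%N ->
  (0 < mk l)%N = adj_at X o l && ~~ (0 < mk l.-1)%N.
Hypothesis spP : forall l, (l < n)%N ->
  sp l = if link_at a o q l then sp l.-1 else mk l.
Hypothesis epP : forall l, (l < n)%N ->
  ep l = if link_at a o q l.+1 then ep l.+1 else mk l.
Hypothesis IP_B : value_mandatory I p \subset B.
Hypothesis B_sub : B \subset value_mandatory I p :|: value_mandatory I w.
Hypothesis B_closed : forall i j, i != j -> j \in B -> inside (I i) (w j) -> i \in B.
Variable BC : {set 'I_n}.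
Hypothesis BCE : forall i : 'I_n, (i \in BC) =
  (i \in B) || [exists l : 'I_n, (o l == i.+1) && chosen_at mk sp ep l].
Variable A : {set 'I_n}.
Hypothesis BCA : BC \subset A.
Hypothesis A_wit : forall i, i \in A -> i \notin BC ->
  exists j, [/\ j \in A, j != i & inside (I i) (w j)].
Hypothesis A_closed : forall i j, i != j -> j \in A -> inside (I i) (w j) -> i \in A.

(** The analysis is instantiated with an optimal feasible set for [OPT] and with the intervals that
    the second phase adds to [B] for [C]. *)
Lemma cover_analysis :
  [/\ feasible I w A, (#|A| <= opt X + k_num X)%N, (#|A| <= opt X + k_M X)%N
    & (#|A| <= 2 * opt X)%N].
Proof.
have [[O fO <-] _] := optP X.
have /(feasibleP (true_valueP X))[O_M O_cover] := fO.
pose C := BC :\: B.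
have x_in k : (k < m)%N -> innermost I (x k) by move=> /position_array_at[].
have mn k : (k < m)%N -> (k < n)%N by move=> km; exact: leq_trans km positions_le_n.
have markE k : (k < m)%N -> (0 < mk k)%N = adj I m x k && ~~ (0 < mk k.-1)%N.
  by move=> /mn kn; rewrite mkP // adj_atE.
have spE k : (k < m)%N -> (0 < sp k)%N =
    if link I m x B k then (0 < sp k.-1)%N else (0 < mk k)%N.
  by move=> /mn kn; rewrite {1}spP // link_atE; case: ifP.
have epE k : (k < m)%N -> (0 < ep k)%N =
    if link I m x B k.+1 then (0 < ep k.+1)%N else (0 < mk k)%N.
  by move=> /mn kn; rewrite {1}epP // link_atE; case: ifP.
have C_in i : i \in C -> innermost I i.
  rewrite inE BCE => /andP[/negbTE-> /existsP[l /andP[/eqP ol _]]].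
  have [|j ij [_ oj]] := oP.2 l; first by rewrite ol.
  by have -> : i = j by apply: val_inj; apply: succn_inj; rewrite -ol -oj.
have CE k : (k < m)%N -> (x k \in C) = (x k \notin B) &&
    ((0 < mk k)%N != (0 < sp k)%N && (0 < ep k)%N).
  move=> km; rewrite inE BCE; case: (x k \in B) => //=.
  have [ok ik] := position_array_at km.
  apply/existsP/idP => [[l /andP[/eqP ol hc]]|h]; last first.
    by exists (Ordinal (mn k km)); rewrite /= ok eqxx.
  have [|j ij [pj oj]] := oP.2 l; first by rewrite ol.
  have xj : x k = j by apply: val_inj; apply: succn_inj; rewrite -ol -oj.
  have lk : l = k :> nat.
    by rewrite -pj -xj; have [i ii <-] := pos_onto km; rewrite at_posK.
  by move: hc; rewrite /chosen_at lk.
have BA : B \subset A.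
  by apply: subset_trans BCA; apply/subsetP=> i iB; rewrite BCE iB.
have CA : C \subset A by apply: subset_trans BCA; exact: subsetDl.
have wit i : i \in A -> i \notin B -> i \notin C ->
    exists j, [/\ j \in A, j != i & inside (I i) (w j)].
  by move=> iA iB; rewrite !inE iB => /(A_wit iA).
split.
- exact: (queried_feasible (true_valueP X) (predictedP X) x_in at_pos_onto at_pos_lt
    IP_B markE spE epE CE BA CA A_closed).
- exact: (card_A_le_wrong (true_valueP X) (predictedP X) O_M O_cover x_in at_pos_onto
    at_pos_lt IP_B B_sub B_closed markE spE epE C_in CE BA CA wit).
- rewrite /k_M (mandatoryE (predictedP X)) (mandatoryE (true_valueP X)).
  exact: (card_A_le_symdiff (predictedP X) O_M O_cover x_in at_pos_onto
    at_pos_lt IP_B B_sub markE spE epE C_in CE BA CA wit).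
- exact: (card_A_le_double (true_valueP X) (predictedP X) O_M O_cover x_in at_pos_onto
    at_pos_lt IP_B B_sub B_closed markE spE epE C_in CE wit).
Qed.

End Positions.

Lemma rank_le (R : realFieldType) (n : nat) (v : 'I_n -> R) i j :
  (#|[set k | (v k < v i)%R]| <= #|[set k | (v k < v j)%R]|)%N = (v i <= v j).
Proof.
apply/idP/idP => [|vij]; last first.
  by apply: subset_leq_card; apply/subsetP=> k; rewrite !inE => /lt_le_trans->.
apply: contraTT; rewrite -ltNge -ltnNge => vji; apply: proper_card.
apply/properP; split; last by exists j; rewrite inE ?vji // ltxx.
by apply/subsetP=> k; rewrite !inE => /lt_trans->.
Qed.

(** * Correctness of the whole program *)

Section Result.
Variables (R : realFieldType) (n : nat) (X : instance R n).
Notation I := (itv X).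
Notation w := (true_value X).
Notation p := (predicted X).

Lemma base_init : base X (init X). Proof. by []. Qed.

(** The contents of array 3 are consistent with the answers, so by feasibility they are ordered like
    the true values although some of them are only predictions. *)
Lemma feasible_outputs_order s s' : qinv X s ->
  feasible I w [set i in queries s] ->
  (forall i : 'I_n, nats s' 1 i =
     #|[set j : 'I_n | reals s 3 (val j) < reals s 3 (val i)]|) ->
  outputs_order X s'.
Proof.
move=> [_ _ v] feas rk i j; rewrite !rk rank_le.
apply: (feas (fun i : 'I_n => reals s 3 (val i)) w); split=> //=.
- by move=> k; rewrite v; case: ifP => _; [exact: true_valueP|exact: predictedP].
- by move=> k; rewrite inE v => ->.
- exact: true_valueP.
Qed.

Lemma runs_sorting_program :
  runs w sorting_program (init X) (fun s =>
    [/\ feasible I w [set i in queries s], outputs_order X s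
      & forall k : nat, k \in [:: k_num X; k_M X; k_h X] ->
        (size (queries s) <= minn (opt X + k) (2 * opt X))%N]).
Proof.
apply: runs_seq; apply: runs_copy_predictions => [|s1 f1 q1 v1]; first exact: base_init.
have b1 := base_frame base_init f1 isT isT.
apply: runs_seq; apply: runs_find_innermost => // [k|s2 f2 q2 g2]; first by rewrite f1.1.
have b2 := base_frame b1 f2 isT isT.
apply: runs_seq; apply: runs_sort_innermost => // [k|s3 f3 q3 o3].
  by rewrite f2.1 // f1.1.
have b3 := base_frame b2 f3 isT isT.
apply: runs_seq; apply: runs_compute_marks => // [k|k|s4 f4 q4 a4 m4].
- by rewrite f3.1 // f2.1 // f1.1.
- by rewrite f3.1 // f2.1 // f1.1.
have b4 := base_frame b3 f4 isT isT.
have Q4 : queries s4 = [::] by rewrite q4 q3 q2 q1.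
have qi4 : qinv X s4.
  split=> [|i|i]; rewrite Q4 //.
    by rewrite f4.1 // f3.1 // f2.1 // f1.1.
  by rewrite f4.2 // f3.2 // f2.2.
apply: runs_seq; apply: runs_close => // s5 f5 qi5 _ j5 c5.
have b5 := base_frame b4 f5 isT isT.
have a5 l : nats s5 7 l = (l < n)%N && adj_at X (nats s5 5) l.
  rewrite f5.1 // a4 /adj_at; do ![rewrite f5.1 //]; do ![rewrite f4.1 //].
apply: runs_seq; apply: runs_compute_starts => //.
  by rewrite a5 andbF.
move=> s6 f6 q6 sp6; have b6 := base_frame b5 f6 isT isT.
apply: runs_seq; apply: runs_compute_ends => //.
move=> s7 f7 q7 ep7; have b7 := base_frame b6 f7 isT isT.
have qi6 := qinv_frame qi5 f6 q6 isT isT.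
have qi7 := qinv_frame qi6 f7 q7 isT isT.
have eqs a b : a =1 b -> a = b :> (nat -> nat) by move=> h; apply/funext.
have o7 : nats s7 5 = nats s3 5.
  apply: eqs => l; by rewrite f7.1 // f6.1 // f5.1 // f4.1.
have oP7 : is_position_array X (nats s7 5) by rewrite o7.
apply: runs_seq; apply: runs_query_cover => //.
move=> s8 f8 qi8 Q8; have b8 := base_frame b7 f8 isT isT.
apply: runs_seq; apply: runs_close => // s9 f9 qi9 sub9 j9 c9.
have b9 := base_frame b8 f9 isT isT.
apply: runs_output_ranks => // s10 q10 r10.
suff [h1 h2 h3 h4] : [/\ feasible I w [set i in queries s9],
    (#|[set i in queries s9]| <= opt X + k_num X)%N,
    (#|[set i in queries s9]| <= opt X + k_M X)%N
    & (#|[set i in queries s9]| <= 2 * opt X)%N].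
  have u9 : uniq (queries s9) by case: qi9.
  rewrite !cardsE (card_uniqP u9) in h2 h3 h4.
  rewrite q10; split=> //; first exact: feasible_outputs_order qi9 h1 r10.
  move=> k; rewrite !inE leq_min h4 andbT => /or3P[] /eqP-> //.
  by apply: leq_trans h3 _; rewrite leq_add2l k_M_le_k_h.
(* Reading positions as intervals needs a default interval, which exists only for positive [n]. *)
have [n0|n_gt0] := posnP n.
  have E0 : [set i in queries s9] = set0.
    by apply/setP=> i; have := ltn_ord i; rewrite {2}n0.
  rewrite !E0 cards0; split=> //.
  move=> v v' _ _ i; exfalso; have := ltn_ord i; by rewrite {2}n0.
have e75 : nats s7 7 = nats s5 7.
  by apply: eqs => l; rewrite f7.1 // f6.1.
have e55 : nats s7 5 = nats s5 5.
  by apply: eqs => l; rewrite f7.1 // f6.1.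
have e65 : nats s7 6 = nats s5 6.
  by apply: eqs => l; rewrite f7.1 // f6.1.
have e64 : nats s5 6 = nats s4 6.
  by apply: eqs => l; rewrite f5.1.
have e87 : nats s7 8 = nats s6 8.
  by apply: eqs => l; rewrite f7.1.
have e66 a : a \in [:: 7; 5; 2; 6]%N -> nats s6 a = nats s5 a.
  move=> ha; apply: eqs => l; rewrite f6.1 //.
  by move: ha; rewrite !inE => /or4P[] /eqP->.
apply: (@cover_analysis _ _ X (nats s7 5) (Ordinal n_gt0) oP7 (nats s7 7)
  (nats s5 2) [set i in queries s5] _ _ (nats s7 6) (nats s7 8) (nats s7 9)
  _ _ _ _ _ _ [set i in queries s8]).
- by move=> l; rewrite e75 e55 a5.
- by case: qi5 => _ h _ i; rewrite h inE.
- move=> l ln; rewrite e65 e64 m4 // o7 //.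
- by move=> l ln; rewrite e87 sp6 // e75 e55 e65.
- by move=> l ln; rewrite ep7 // !e66 // e75 e55 e65.
- apply/subsetP=> i /value_mandatoryP[j ji h]; rewrite inE; apply: c5 ji _.
  by rewrite /addable h.
- apply/subsetP=> i; rewrite inE => iq; have [|j ji] := j5 i iq; first by rewrite Q4.
  rewrite in_setU => /orP[h|/andP[_ h]].
    by apply/orP; left; apply/value_mandatoryP; exists j.
  by apply/orP; right; apply/value_mandatoryP; exists j.
- move=> i j ij; rewrite !inE => jq h; apply: (c5 i j); first by rewrite eq_sym.
  by rewrite /addable jq h orbT.
- by move=> i; rewrite !inE Q8 q7 q6.
- by apply/subsetP=> i; rewrite !inE => /sub9.
(* A late query is triggered by a true value, since the first closure has already queried whatever a
   prediction triggers. *)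
- move=> i; rewrite !inE => iq niq; have [j ji] := j9 i iq niq.
  move=> /orP[h|/andP[jq h]]; last by exists j; rewrite inE.
  have : i \in queries s8.
    by rewrite Q8 q7 q6; apply/orP; left; apply: c5 ji _; rewrite /addable h.
  by rewrite (negbTE niq).
- move=> i j ij; rewrite !inE => jq h; apply: (c9 i j); first by rewrite eq_sym.
  by rewrite /addable jq h orbT.
Qed.

End Result.

Local Close Scope ring_scope.

Theorem theorem11 (R : realFieldType) :
  exists (A : program) (c d : nat),
  forall (n : nat) (X : instance R n),
  exists (s : state R n) (t : nat),
    [/\ exec (true_value X) A (init X) t s,
        t <= c * n ^ d + c,
        feasible (itv X) (true_value X) [set i in queries s],
        outputs_order X s
      & forall k : nat, k \in [:: k_num X; k_M X; k_h X] ->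
        size (queries s) <= minn (opt X + k) (2 * opt X)].
Proof.
have [c [d time_le]] := time_polynomial sorting_program.
exists sorting_program, c, d => n X.
have [t [s [run t_le [feas order le]]]] := runs_sorting_program X.
by exists s, t; split=> //; exact: leq_trans t_le (time_le n).
Qed.
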